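(* Let $(A,\succ)$ be a finite-dimensional Zinbiel algebra, $(A_h,\succ_h,\prec_h)$ a dendriform deformation of it and $(A,\triangleright,\succ)$ the quasiclassical limit pre-Poisson algebra. Put $x\circ y:=x\succ y+y\succ x$ and $\{x,y\}:=x\triangleright y-y\triangleright x$ on $A$, and $x\circ_hy:=x\succ_hy+x\prec_hy$ on $A_h$. Let $r:=\eta(\widetilde{\mathrm{id}_A})-\sigma(\eta(\widetilde{\mathrm{id}_A}))\in(A\oplus A^* )^{\otimes2}$ and $r_h:=\eta_h(\widetilde{\mathrm{id}_{A_h}})-\sigma_{\mathbf K}(\eta_h(\widetilde{\mathrm{id}_{A_h}}))\in(A\oplus A^* )_h\hat\otimes(A\oplus A^* )_h$. Then: (1) The topologically free associative algebra $A_h\ltimes_{-R^\star_{\prec_h},-L^\star_{\succ_h}}A_h^\star$ is an associative deformation of the commutative associative algebra $A\ltimes_{-L_\succ^*}A^*$, and its quasiclassical limit is exactly the Poisson algebra $A\ltimes_{L_\triangleright^*,-L_\succ^*}A^*$. (2) Starting from the Zinbiel algebra $(A,\succ)$: the $\mathcal O$-operator $\mathrm{id}_{A_h}$ on $(A_h,\circ_h)$ associated to $(A_h,L_{\succ_h},R_{\prec_h})$ is the scalar deformation of the $\mathcal O$-operator $\mathrm{id}_A$ on $(A,\circ)$ associated to $(A,L_\succ)$, and the induced skew-symmetric solution $r_h$ of the AYBE in $A_h\ltimes_{-R^\star_{\prec_h},-L^\star_{\succ_h}}A_h^\star$ is the scalar deformation $\hat r$ of the induced skew-symmetric solution $r$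 of the AYBE in $A\ltimes_{-L^*_\succ}A^*$. Moreover, starting from the topologically free dendriform algebra $(A_h,\succ_h,\prec_h)$: the $\mathcal O$-operator $\mathrm{id}_A$ on $(A,\{,\},\circ)$ associated to $(A,L_\triangleright,L_\succ)$ induced by the pre-Poisson algebra $(A,\triangleright,\succ)$ coincides with the one obtained from $\mathrm{id}_{A_h}$ by passing to quasiclassical limits, and the skew-symmetric solution of the PYBE in $A\ltimes_{L_\triangleright^*,-L_\succ^*}A^*$ that it induces is $r$ and coincides with the solution of the PYBE obtained from the solution $r_h=\hat r$ of the AYBE by passing to the quasiclassical limit.
   Context: Throughout, $\mathbf{k}$ is a field of characteristic $0$, $\mathbf{K}=\mathbf{k}[[h]]$, $V_h=V[[h]]$; $\hat\otimes$ is the $h$-adically completed tensor product over $\mathbf K$, $V_h\hat\otimes W_h\cong(V\otimes W)[[h]]$. $L_*(x)y=x*y$, $R_*(x)y=y*x$. An associative deformation of $(A,\circ)$ is a $\mathbf K$-bilinear associative product $\circ_h$ on $A_h$ with $x\circ_hy\equiv x\circ y\pmod h$; for $(A,\circ)$ commutative its quasiclassical limit (QCL) is the Poisson algebra $(A,\{,\},\circ)$, $\{x,y\}\equiv\frac{x\circ_hy-y\circ_hx}{h}\pmod h$. A dendriform algebra $(A,\succ,\prec)$ satisfies, with $x\circ y=x\prec y+x\succ y$: $(x\prec y)\prec z=x\prec(y\circ z)$, $(x\succ y)\prec z=x\succ(y\prec z)$, $(x\circ y)\succ z=x\succ(y\succ z)$. A Zinbiel algebra $(A,\succ)$ is a dendriform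 algebra with $x\succ y=y\prec x$. A dendriform deformation is a dendriform algebra $(A_h,\succ_h,\prec_h)$ with $\mathbf K$-bilinear operations on $A_h=A[[h]]$ reducing mod $h$ to $\succ,\prec$ on $A$; the QCL of a dendriform deformation of a Zinbiel algebra is $(A,\triangleright,\succ)$ with $x\triangleright y\equiv\frac{x\succ_hy-y\prec_hx}{h}\pmod h$, which is known to be a pre-Poisson algebra: $(A,\succ)$ is Zinbiel, $(A,\triangleright)$ is pre-Lie, $(x\circ y)\triangleright z=x\succ(y\triangleright z)+y\succ(x\triangleright z)$ and $x\triangleright(y\succ z)=y\succ(x\triangleright z)+\{x,y\}\succ z$. An $A$-bimodule $(V,l,r)$ over associative $(A,\circ)$: $A\oplus V$ with $(x,u)\odot(y,v)=(x\circ y,l(x)v+r(y)u)$ is associative, written $A\ltimes_{l,r}V$; for commutative $A$, a module $(V,\rho_\circ)$ is the case $l=r=\rho_\circ$. A module $(V,\rho_{\{,\}},\rho_\circ)$ over a Poisson algebra: $A\oplus V$ with bracket $(\{x,y\},\rho_{\{,\}}(x)v-\rho_{\{,\}}(y)u)$ and product $(x\circ y,\rho_\circ(x)v+\rho_\circ(y)u)$ is Poisson, written $A\ltimes_{\rho_{\{,\}},\rho_\circ}V$. $\mathcal O$-operators: $T:V\to A$ with $T(u)\circ T(v)=T(l(T(u))v)+T(r(T(v))u)$ (also over $\mathbf K$); in the Poisson case $T(u)\circ T(v)=T(\rho_\circ(T(u))v)+T(\rho_\circ(T(v))u)$ and $\{T(u),T(v)\}=T(\rho_{\{,\}}(T(u))v)-T(\rho_{\{,\}}(T(v))u)$.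 Scalar deformations: $T_{\mathbf K}(\sum v_ih^i)=\sum T(v_i)h^i$; for a tensor $r\in B\otimes B$, $\hat r$ is its image in $B_h\hat\otimes B_h$. Known: $\mathrm{id}_A$ (resp. $\mathrm{id}_{A_h}$, resp. $\mathrm{id}_A$) is an $\mathcal O$-operator on $(A,\circ)$ (resp. $(A_h,\circ_h)$, resp. $(A,\{,\},\circ)$) associated to $(A,L_\succ)$ (resp. $(A_h,L_{\succ_h},R_{\prec_h})$, resp. $(A,L_\triangleright,L_\succ)$). Duals: $\langle\varrho^*(x)u^*,v\rangle=-\langle u^*,\varrho(x)v\rangle$; $V_h^\star:=(V^* )_h\cong\mathrm{Hom}_{\mathbf K}(V_h,\mathbf K)$ with $\mathbf K$-bilinear pairing $\langle,\rangle_{\mathbf K}$, $\langle\varrho_h^\star(x)u^\star,v\rangle_{\mathbf K}=-\langle u^\star,\varrho_h(x)v\rangle_{\mathbf K}$. $\widetilde{\mathrm{id}_A}\in A\otimes A^*$ and $\widetilde{\mathrm{id}_{A_h}}\in A_h\hat\otimes A_h^\star$ are the tensors of the identity maps ($\sum_ie_i\otimes e_i^*$ for a basis of $A$). $\eta:A\otimes A^*\to(A\oplus A^* )^{\otimes2}$, $a\otimes f\mapsto(a,0)\otimes(0,f)$; $\eta_h$ is its analogue $A_h\hat\otimes A_h^\star\to(A\oplus A^* )_h\hat\otimes(A\oplus A^* )_h$; $\sigma$ is the flip and $\sigma_{\mathbf K}$ its $\mathbf K$-linear extension. For $r=\sum_ia_i\otimes b_i$: AYBE is $\mathbf A(r)=\sum_{i,j}\big(a_i\circ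 a_j\otimes b_i\otimes b_j+a_i\otimes a_j\otimes b_i\circ b_j-a_j\otimes a_i\circ b_j\otimes b_i\big)=0$ (same over $\mathbf K$); CYBE is $\mathbf C(r)=\sum_{i,j}\big(\{a_i,a_j\}\otimes b_i\otimes b_j+a_i\otimes\{b_i,a_j\}\otimes b_j+a_i\otimes a_j\otimes\{b_i,b_j\}\big)=0$; PYBE is $\mathbf A(r)=\mathbf C(r)=0$ (with the product and bracket of the relevant algebra). *)

(* Defs.v *)
From HB Require Import structures.
From mathcomp Require Import all_boot all_order all_algebra.
From mathcomp Require Import boolp functions.

Set Implicit Arguments.
Unset Strict Implicit.
Unset Printing Implicit Defensive.

Import GRing.Theory.
Local Open Scope ring_scope.

(* [fps V] is V[[h]]: the series \sum_n v_n h^n is the function n |-> v_n. *)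
Definition fps (V : Type) : Type := nat -> V.

HB.instance Definition _ (V : zmodType) :=
  GRing.Zmodule.copy (fps V) (nat -> V).

Lemma fpsP (V : Type) (u v : fps V) : (forall n, u n = v n) -> u = v.
Proof. by move=> uv; apply/funext. Qed.

Lemma fpsD (V : zmodType) (u v : fps V) n : (u + v) n = u n + v n.
Proof. by []. Qed.

Lemma fpsN (V : zmodType) (u : fps V) n : (- u) n = - u n.
Proof. by []. Qed.

Lemma fps0 (V : zmodType) n : (0 : fps V) n = 0.
Proof. by []. Qed.

Lemma fps_sum (V : zmodType) I (r : seq I) (P : pred I) (F : I -> fps V) n :
  (\sum_(i <- r | P i) F i) n = \sum_(i <- r | P i) F i n.
Proof. by rewrite (big_morph (fun u : fps V => u n) (id1 := 0) (op1 := +%R)). Qed.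

(* The h-adically continuous extension of a biadditive map to series. *)
Definition cauchy (U V W : zmodType) (f : U -> V -> W)
  (u : fps U) (v : fps V) : fps W :=
  fun n => \sum_(i < n.+1) f (u i) (v (n - i)%N).

Definition fcst (V : zmodType) (v : V) : fps V :=
  fun n => if n is 0 then v else 0.

Definition modh (V : Type) (u : fps V) : V := u 0%N.

(* u / h, for u divisible by h; see [divhK] *)
Definition divh (V : Type) (u : fps V) : fps V := fun n => u n.+1.

Section CauchyTheory.

Lemma cauchy_rev (U V W : zmodType) (f : U -> V -> W) u v n :
  cauchy f u v n = \sum_(i < n.+1) f (u (n - i)%N) (v i).
Proof.
rewrite /cauchy (reindex_inj rev_ord_inj) /=; apply: eq_bigr => i _.
by rewrite !subSS subKn // -ltnS.
Qed.

Lemma cauchyA (U V W X Y Z : zmodType)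
    (f : U -> X -> Z) (g : V -> W -> X) (f' : Y -> W -> Z) (g' : U -> V -> Y) :
    (forall u, {morph f u : x y / x + y}) ->
    (forall w, {morph f'^~ w : x y / x + y}) ->
    (forall u v w, f u (g v w) = f' (g' u v) w) ->
  forall u v w, cauchy f u (cauchy g v w) = cauchy f' (cauchy g' u v) w.
Proof.
move=> fD f'D fg u v w; apply: fpsP => n; rewrite [RHS]cauchy_rev.
have f0 x : f x 0 = 0 by apply: (addIr (f x 0)); rewrite -fD !add0r.
have f'0 x : f' 0 x = 0.
  by apply: (addIr (f' 0 x)); rewrite -(f'D x) !add0r.
pose F j m := f (u j) (g (v (n - j - m)%N) (w m)).
transitivity (\sum_(j < n.+1) \sum_(m < n.+1 | (m <= n - j)%N) F j m).
  apply: eq_bigr => /= j _; rewrite cauchy_rev.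
  rewrite (big_morph (f (u j)) (fD _) (f0 _)).
  by rewrite (big_ord_narrow_leq (leq_subr _ _)).
rewrite (exchange_big_dep predT) //=; apply: eq_bigr => m _.
transitivity (\sum_(j < n.+1 | (j <= n - m)%N) F j m).
  apply: eq_bigl => j; rewrite -ltnS -(ltnS j) -!subSn ?leq_ord //.
  by rewrite -subn_gt0 -(subn_gt0 j) -!subnDA addnC.
rewrite (big_ord_narrow_leq (leq_subr _ _)).
rewrite (big_morph (f'^~ (w m)) (f'D _) (f'0 _)).
by apply: eq_bigr => j _; rewrite /F fg -!subnDA addnC.
Qed.

Lemma cauchyDl (U V W : zmodType) (f : U -> V -> W) v :
  (forall w, {morph f^~ w : x y / x + y}) -> {morph cauchy f ^~ v : x y / x + y}.
Proof.
move=> fD x y; apply: fpsP => n; rewrite fpsD /cauchy -big_split /=.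
by apply: eq_bigr => i _; rewrite fpsD (fD _).
Qed.

Lemma cauchyDr (U V W : zmodType) (f : U -> V -> W) u :
  (forall w, {morph f w : x y / x + y}) -> {morph cauchy f u : x y / x + y}.
Proof.
move=> fD x y; apply: fpsP => n; rewrite fpsD /cauchy -big_split /=.
by apply: eq_bigr => i _; rewrite fpsD (fD _).
Qed.

Lemma cauchy_cstl (U V W : zmodType) (f : U -> V -> W) x v n :
  (forall w, f 0 w = 0) -> cauchy f (fcst x) v n = f x (v n).
Proof.
by move=> f0; rewrite /cauchy big_ord_recl /= subn0 big1 ?addr0.
Qed.

Lemma cauchy_cstr (U V W : zmodType) (f : U -> V -> W) u y n :
  (forall w, f w 0 = 0) -> cauchy f u (fcst y) n = f (u n) y.
Proof.
by move=> f0; rewrite cauchy_rev big_ord_recl /= subn0 big1 ?addr0.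
Qed.

End CauchyTheory.

Section FpsRing.
Variable R : comNzRingType.

Let one : fps R := fcst 1.
Let mul : fps R -> fps R -> fps R := cauchy *%R.

Let mulA : associative mul.
Proof.
move=> x y z; apply: cauchyA => [u|w|]; last exact: mulrA.
- exact: mulrDr.
- by move=> a b; exact: mulrDl.
Qed.

Let mulC : commutative mul.
Proof.
move=> x y; apply: fpsP => n; rewrite /mul cauchy_rev.
by apply: eq_bigr => i _; exact: mulrC.
Qed.

Let mul1 : left_id one mul.
Proof.
move=> x; apply: fpsP => n; rewrite /mul cauchy_cstl ?mul1r // => w.
exact: mul0r.
Qed.

Let mulD : left_distributive mul +%R.
Proof. by move=> x y z; apply: cauchyDl => w a b; exact: mulrDl. Qed.

Let one_neq0 : one != 0.
Proof.
by apply/eqP => /(congr1 (fun f : fps R => f 0%N)) /eqP; rewrite fps0 oner_eq0.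
Qed.

HB.instance Definition _ :=
  GRing.Zmodule_isComNzRing.Build (fps R) mulA mulC mul1 mulD one_neq0.

End FpsRing.

Section FpsModule.
Variables (R : comNzRingType) (V : lmodType R).

Let scale : fps R -> fps V -> fps V := cauchy *:%R.

Let scaleA a b v : scale a (scale b v) = scale (a * b) v.
Proof.
apply: cauchyA => [u|w|]; last exact: scalerA.
- exact: scalerDr.
- by move=> x y; exact: scalerDl.
Qed.

Let scale1 : left_id 1 scale.
Proof.
move=> x; apply: fpsP => n; rewrite /scale cauchy_cstl ?scale1r // => w.
exact: scale0r.
Qed.

Let scaleDr : right_distributive scale +%R.
Proof. by move=> a x y; apply: cauchyDr => w; exact: scalerDr. Qed.

Let scaleDl v : {morph scale^~ v : a b / a + b}.
Proof. by apply: cauchyDl => w a b; exact: scalerDl. Qed.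

HB.instance Definition _ :=
  GRing.Zmodule_isLmodule.Build (fps R) (fps V) scaleA scale1 scaleDr scaleDl.

End FpsModule.

Definition hvar (R : comNzRingType) : fps R := fun n => (n == 1%N)%:R.

Definition smap (U V : Type) (T : U -> V) (u : fps U) : fps V := fun n => T (u n).

Section FpsLinear.
Variable R : comNzRingType.

Lemma fpsZ (V : lmodType R) (a : fps R) (v : fps V) n :
  (a *: v) n = \sum_(i < n.+1) a i *: v (n - i)%N.
Proof. by []. Qed.

Lemma fps_cstZ (V : lmodType R) (a : R) (v : fps V) n :
  (fcst a *: v) n = a *: v n.
Proof. by apply: cauchy_cstl => w; exact: scale0r. Qed.

Lemma fpsZ_cst (V : lmodType R) (a : fps R) (v : V) n :
  (a *: fcst v) n = a n *: v.
Proof. by apply: cauchy_cstr => w; exact: scaler0. Qed.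

Lemma hvarZ (V : lmodType R) (v : fps V) n :
  (hvar R *: v) n = if n is m.+1 then v m else 0.
Proof.
case: n => [|n].
  by rewrite fpsZ big_ord_recl big_ord0 /hvar /= scale0r addr0.
rewrite fpsZ 2!big_ord_recl big1 => [|i _]; last by rewrite /hvar /= scale0r.
by rewrite /hvar /= scale0r add0r addr0 scale1r /bump /= subSS subn0.
Qed.

Lemma divhK (V : lmodType R) (v : fps V) : modh v = 0 -> hvar R *: divh v = v.
Proof. by move=> v0; apply: fpsP => -[|n]; rewrite hvarZ. Qed.

Lemma fcst_modh (V : lmodType R) (v : fps V) :
  v = fcst (modh v) + hvar R *: divh v.
Proof.
by apply: fpsP => -[|n]; rewrite fpsD hvarZ /= /modh /divh ?addr0 ?add0r.
Qed.

Lemma fcst_is_additive (V : zmodType) : {morph @fcst V : x y / x + y}.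
Proof. by move=> x y; apply: fpsP => -[|n]; rewrite fpsD //= addr0. Qed.

Lemma fcstZ (V : lmodType R) (a : R) (v : V) :
  fcst (a *: v) = fcst a *: fcst v.
Proof. by apply: fpsP => -[|n]; rewrite fps_cstZ //= scaler0. Qed.

Lemma linD (S : pzRingType) (U V : lmodType S) (f : U -> V) :
  linear f -> {morph f : x y / x + y}.
Proof. by move=> fl x y; have := fl 1 x y; rewrite !scale1r. Qed.

Lemma lin0 (S : pzRingType) (U V : lmodType S) (f : U -> V) : linear f -> f 0 = 0.
Proof. by move=> fl; apply: (addIr (f 0)); rewrite -(linD fl) !add0r. Qed.

Lemma linZ (S : pzRingType) (U V : lmodType S) (f : U -> V) :
  linear f -> forall a x, f (a *: x) = a *: f x.
Proof. by move=> fl a x; have := fl a x 0; rewrite (lin0 fl) !addr0. Qed.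

Lemma lin_sum (S : pzRingType) (U V : lmodType S) (f : U -> V) :
  linear f -> forall I (r : seq I) (P : pred I) (F : I -> U),
  f (\sum_(i <- r | P i) F i) = \sum_(i <- r | P i) f (F i).
Proof. by move=> fl I r P F; exact: (big_morph f (linD fl) (lin0 fl)). Qed.

(* A k[[h]]-linear map is automatically h-adically continuous. *)
Lemma fps_linear_cont (U V : lmodType R) (f : fps U -> fps V) :
  linear f -> forall n u v, (forall i, (i <= n)%N -> u i = v i) ->
  f u n = f v n.
Proof.
move=> fl; elim=> [|n IH] u v uv.
  rewrite (fcst_modh u) (fcst_modh v) !(linD fl) !(linZ fl) !fpsD !hvarZ.
  by rewrite /modh uv.
rewrite (fcst_modh u) (fcst_modh v) !(linD fl) !(linZ fl) !fpsD !hvarZ.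
by rewrite /modh uv //; congr (_ + _); apply: IH => i le_in; exact: uv.
Qed.

(* Two k[[h]]-linear maps which agree on V agree on V[[h]]. *)
Lemma fps_linear_eq (U V : lmodType R) (f g : fps U -> fps V) :
  linear f -> linear g -> (forall v, f (fcst v) = g (fcst v)) -> f =1 g.
Proof.
move=> fl gl fg u; apply: fpsP => n; elim: n u => [|n IH] u.
  by rewrite (fcst_modh u) !(linD fl, linD gl) !(linZ fl, linZ gl) !fpsD !hvarZ fg.
rewrite (fcst_modh u) !(linD fl, linD gl) !(linZ fl, linZ gl) !fpsD !hvarZ fg.
by rewrite IH.
Qed.

Lemma cauchy_linl (U V W : lmodType R) (f : U -> V -> W) :
  (forall y, linear (f^~ y)) -> forall v, linear (cauchy f ^~ v).
Proof.
move=> fl v a x y; rewrite (cauchyDl _ (fun w => linD (fl w))).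
congr (_ + _); apply/esym/cauchyA => [w|w|u z w].
- exact: scalerDr.
- exact: (linD (fl w)).
- by rewrite (linZ (fl w)).
Qed.

Lemma cauchy_linr (U V W : lmodType R) (f : U -> V -> W) :
  (forall x, linear (f x)) -> forall u, linear (cauchy f u).
Proof.
move=> fl u a x y; rewrite (cauchyDr _ (fun w => linD (fl w))).
congr (_ + _).
pose g (v : V) (b : R) := b *: v; pose g' (w : W) (b : R) := b *: w.
have sw (X : lmodType R) (b : fps R) (z : fps X) :
    cauchy (fun (z : X) (b : R) => b *: z) z b = b *: z.
  by apply: fpsP => n; rewrite cauchy_rev.
rewrite -!sw; apply: cauchyA => [z|w|z w b].
- exact: (linD (fl z)).
- by move=> b c; exact: scalerDr.
- exact: (linZ (fl z)).
Qed.

End FpsLinear.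

Section Algebras.
Variables (R : comNzRingType) (A : lmodType R).
Implicit Types mu br succ prec tri : A -> A -> A.

Definition bilin (U V W : lmodType R) (f : U -> V -> W) : Prop :=
  (forall y, linear (f^~ y)) /\ (forall x, linear (f x)).

Definition assoc_algebra mu : Prop := bilin mu /\ associative mu.

Definition comm_assoc_algebra mu : Prop := assoc_algebra mu /\ commutative mu.

Definition lie_algebra br : Prop :=
  [/\ bilin br, forall x, br x x = 0
    & forall x y z, br x (br y z) + br y (br z x) + br z (br x y) = 0].

Definition poisson_algebra br mu : Prop :=
  [/\ lie_algebra br, comm_assoc_algebra mu
    & forall x y z, br x (mu y z) = mu (br x y) z + mu y (br x z)].

Definition dsum_op succ prec (x y : A) : A := prec x y + succ x y.

Definition dendriform_algebra succ prec : Prop :=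
  let circ := dsum_op succ prec in
  [/\ bilin succ, bilin prec,
      forall x y z, prec (prec x y) z = prec x (circ y z),
      forall x y z, prec (succ x y) z = succ x (prec y z)
    & forall x y z, succ (circ x y) z = succ x (succ y z)].

Definition zinbiel_algebra succ : Prop :=
  dendriform_algebra succ (fun x y => succ y x).

Definition zinbiel_prod succ (x y : A) : A := succ x y + succ y x.

Definition commutator tri (x y : A) : A := tri x y - tri y x.

(* left-symmetric convention *)
Definition prelie_algebra tri : Prop :=
  bilin tri /\
  forall x y z, tri (tri x y) z - tri x (tri y z)
              = tri (tri y x) z - tri y (tri x z).

Definition prepoisson_algebra tri succ : Prop :=
  [/\ zinbiel_algebra succ, prelie_algebra tri,
      forall x y z, tri (zinbiel_prod succ x y) z
                    = succ x (tri y z) + succ y (tri x z)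
    & forall x y z, tri x (succ y z)
                    = succ y (tri x z) + succ (commutator tri x y) z].

Definition Lmul mu (x y : A) : A := mu x y.
Definition Rmul mu (x y : A) : A := mu y x.

Variable V : lmodType R.
Implicit Types (l r rho rhob : A -> V -> V) (T : V -> A).

Definition sdprod mu l r (x y : A * V) : A * V :=
  (mu x.1 y.1, l x.1 y.2 + r y.1 x.2).

Definition sdbracket br rhob (x y : A * V) : A * V :=
  (br x.1 y.1, rhob x.1 y.2 - rhob y.1 x.2).

End Algebras.

Section OOperators.
Variables (R : comNzRingType) (A V : lmodType R).
Implicit Types (mu br : A -> A -> A) (l r rho rhob : A -> V -> V) (T : V -> A).

Definition bimodule mu l r : Prop :=
  assoc_algebra mu /\ assoc_algebra (sdprod mu l r : A * V -> A * V -> A * V).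

Definition poisson_module br mu rhob rho : Prop :=
  poisson_algebra br mu /\
  poisson_algebra (sdbracket br rhob : A * V -> A * V -> A * V)
                  (sdprod mu rho rho).

Definition o_operator mu l r T : Prop :=
  [/\ bimodule mu l r, linear T
    & forall u v, mu (T u) (T v) = T (l (T u) v) + T (r (T v) u)].

Definition poisson_o_operator br mu rhob rho T : Prop :=
  [/\ poisson_module br mu rhob rho, linear T,
      forall u v, mu (T u) (T v) = T (rho (T u) v) + T (rho (T v) u)
    & forall u v, br (T u) (T v) = T (rhob (T u) v) - T (rhob (T v) u)].

End OOperators.

Section Tensors.
Variable k : fieldType.
Implicit Types A U V W : vectType k.

Definition ebas V (i : 'I_(\dim {:V})) : V := (vbasis {:V})`_i.

Definition ecoord V (i : 'I_(\dim {:V})) (v : V) : k :=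
  coord (vbasis {:V}) i v.

Lemma ebasE V (v : V) : v = \sum_i ecoord i v *: ebas i.
Proof. exact: coord_vbasis (memvf v). Qed.

Lemma ecoord_lin V i : linear (@ecoord V i : V -> k^o).
Proof. by move=> a x y; rewrite /ecoord linearP. Qed.

Lemma ecoord_ebas V (i j : 'I_(\dim {:V})) : ecoord i (ebas j) = (i == j)%:R.
Proof. by rewrite /ecoord /ebas eq_sym coord_free ?(basis_free (vbasisP _)). Qed.

Definition dual V : vectType k := 'Hom(V, k^o).

Definition dsum V W : vectType k := (V * W)%type.

(* V ⊗ W is realised by the matrices of coefficients in the tensor basis
   e_i ⊗ e_j; its universal property is [tlift_lin], [tlift_ten],
   [tlift_uniq]. *)
Definition tens V W : vectType k := 'M[k]_(\dim {:V}, \dim {:W}).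

Definition ten V W (v : V) (w : W) : tens V W :=
  \matrix_(i, j) (ecoord i v * ecoord j w).

Definition tlift V W (X : lmodType k) (f : V -> W -> X) (t : tens V W) : X :=
  \sum_i \sum_j (t : 'M[k]_(_, _)) i j *: f (ebas i) (ebas j).

Lemma ten_bilin V W : bilin (@ten V W).
Proof.
split=> [w a x y|v a x y]; apply/matrixP => i j; rewrite !mxE ecoord_lin /=.
  by rewrite mulrDl -mulrA.
by rewrite mulrDr mulrCA.
Qed.

Lemma tlift_lin V W (X : lmodType k) (f : V -> W -> X) : linear (tlift f).
Proof.
move=> a s t; rewrite /tlift scaler_sumr -big_split /=; apply: eq_bigr => i _.
rewrite scaler_sumr -big_split /=; apply: eq_bigr => j _.
by rewrite !mxE scalerDl scalerA.
Qed.

Lemma tlift_ten V W (X : lmodType k) (f : V -> W -> X) :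
  bilin f -> forall v w, tlift f (ten v w) = f v w.
Proof.
move=> [fl fr] v w; rewrite {2}(ebasE v) (lin_sum (fl w)); apply: eq_bigr => i _.
rewrite (linZ (fl w)) {2}(ebasE w) (lin_sum (fr _)) scaler_sumr.
by apply: eq_bigr => j _; rewrite mxE (linZ (fr _)) scalerA.
Qed.

Lemma tens_basis V W (t : tens V W) :
  t = \sum_i \sum_j (t : 'M[k]_(_, _)) i j *: ten (ebas i) (ebas j).
Proof.
have delta i j : ten (ebas i) (ebas j) = delta_mx i j :> tens V W.
  apply/matrixP => i' j'; rewrite !mxE !ecoord_ebas.
  by case: eqP => _; case: eqP => _; rewrite ?mulr1 ?mulr0 ?mul0r.
rewrite {1}[t](matrix_sum_delta (t : 'M[k]_(_, _))).
by apply: eq_bigr => i _; apply: eq_bigr => j _; rewrite delta.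
Qed.

Lemma tlift_uniq V W (X : lmodType k) (f : V -> W -> X) (g : tens V W -> X) :
  linear g -> (forall v w, g (ten v w) = f v w) -> g =1 tlift f.
Proof.
move=> gl gf t; rewrite {1}(tens_basis t) (lin_sum gl); apply: eq_bigr => i _.
rewrite (lin_sum gl); apply: eq_bigr => j _; by rewrite (linZ gl) gf.
Qed.

Definition tflip V W : tens V W -> tens W V := tlift (fun v w => ten w v).

(* eta : V ⊗ W -> (V ⊕ W) ⊗ (V ⊕ W),  a ⊗ f |-> (a, 0) ⊗ (0, f) *)
Definition teta V W : tens V W -> tens (dsum V W) (dsum V W) :=
  tlift (fun v w => ten ((v, 0) : dsum V W) ((0, w) : dsum V W)).

Definition edual V (i : 'I_(\dim {:V})) : dual V :=
  linfun (@ecoord V i : V -> k^o).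

(* T corresponds to \sum_i T(e_i) ⊗ e_i^* under Hom(V, A) = A ⊗ V^*; see
   [map_tensorE]. *)
Definition map_tensor A V (T : V -> A) : tens A (dual V) :=
  \sum_i ten (T (ebas i)) (edual i).

Lemma edualE V i (v : V) : (edual i : 'Hom(V, k^o)) v = ecoord i v.
Proof.
pose f := GRing.isLinear.Build k V k^o _ (@ecoord V i) (@ecoord_lin V i).
by rewrite /edual (lfunE (HB.pack_for {linear V -> k^o} (@ecoord V i : V -> k^o) f)).
Qed.

Lemma map_tensorE A V (T : V -> A) (v : V) : linear T ->
  tlift (fun (a : A) (f : dual V) => (f : 'Hom(V, k^o)) v *: a) (map_tensor T)
  = T v.
Proof.
move=> Tl; rewrite /map_tensor (lin_sum (tlift_lin _)) [in RHS](ebasE v).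
rewrite (lin_sum Tl); apply: eq_bigr => i _.
rewrite tlift_ten ?edualE ?(linZ Tl) //; split=> [f a x y|a b f g].
  by rewrite scalerDr !scalerA mulrC.
by rewrite add_lfunE scale_lfunE scalerDl scalerA.
Qed.

(* rho^*, with <rho^*(x) u, v> = - <u, rho(x) v> *)
Definition dual_rep A V (rho : A -> V -> V) (x : A) (u : dual V) : dual V :=
  linfun (fun v : V => - (u : 'Hom(V, k^o)) (rho x v)).

Lemma linfunE V (X : vectType k) (f : V -> X) : linear f -> linfun f =1 f.
Proof.
move=> fl v; pose fm := GRing.isLinear.Build k V X _ f fl.
exact: (lfunE (HB.pack_for {linear V -> X} f fm)).
Qed.

Lemma dual_repE A V (rho : A -> V -> V) x (u : dual V) (v : V) :
  linear (rho x) ->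
  (dual_rep rho x u : 'Hom(V, k^o)) v = - (u : 'Hom(V, k^o)) (rho x v).
Proof.
move=> rl; rewrite linfunE // => a y z.
by rewrite rl linearP opprD scalerN.
Qed.

Definition opp_rep (A V : Type) (W : zmodType) (rho : A -> V -> W) x u := - rho x u.

Definition skew_sym V (r : tens V V) : Prop := r + tflip r = 0.

(* For r = \sum_i a_i ⊗ b_i the outer lift binds (a, b) = (a_i, b_i) and the
   inner one (a', b') = (a_j, b_j); see [aybe_formE] and [cybe_formE]. *)
Definition aybe_form V (mu : V -> V -> V) (r : tens V V) : tens V (tens V V) :=
  tlift (fun a b => tlift (fun a' b' =>
      ten (mu a a') (ten b b') + ten a (ten a' (mu b b'))
      - ten a' (ten (mu a b') b)) r) r.

Definition cybe_form V (br : V -> V -> V) (r : tens V V) : tens V (tens V V) :=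
  tlift (fun a b => tlift (fun a' b' =>
      ten (br a a') (ten b b') + ten a (ten (br b a') b')
      + ten a (ten a' (br b b'))) r) r.

Lemma tlift_param_lin V W (Y : lmodType k) (X : lmodType k)
    (f : Y -> V -> W -> X) (t : tens V W) :
  (forall v w, linear (fun y => f y v w)) -> linear (fun y => tlift (f y) t).
Proof.
move=> fl a x y; rewrite /tlift scaler_sumr -big_split /=.
apply: eq_bigr => i _; rewrite scaler_sumr -big_split /=.
by apply: eq_bigr => j _; rewrite fl scalerDr !scalerA mulrC.
Qed.

Lemma comb3 (S : pzRingType) (X : lmodType S) (a : S) (x x' x'' y y' y'' : X) :
  (a *: x + y) + (a *: x' + y') + (a *: x'' + y'')
  = a *: (x + x' + x'') + (y + y' + y'').
Proof.
rewrite !scalerDr -!addrA; do !rewrite [y + (_ + _)]addrCA.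
by do !rewrite [y' + (_ + _)]addrCA.
Qed.

Lemma aybe_formE V (mu : V -> V -> V) n (a b : 'I_n -> V) : bilin mu ->
  aybe_form mu (\sum_i ten (a i) (b i)) =
  \sum_i \sum_j (ten (mu (a i) (a j)) (ten (b i) (b j))
                 + ten (a i) (ten (a j) (mu (b i) (b j)))
                 - ten (a j) (ten (mu (a i) (b j)) (b i))).
Proof.
move=> [mul mur]; rewrite /aybe_form (lin_sum (tlift_lin _)).
have tl X Y w : linear (fun v => @ten X Y v w) by case: (ten_bilin X Y).
have tr X Y v : linear (@ten X Y v) by case: (ten_bilin X Y).
apply: eq_bigr => i _; rewrite tlift_ten; last first.
  split=> [y|x]; apply: tlift_param_lin => v w c p q;
  by rewrite -!scaleN1r !(tl, tr, mul, mur) !scalerDr !scalerA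
             -?(mulrC c) -!scalerA comb3 ?scalerDr.
rewrite (lin_sum (tlift_lin _)); apply: eq_bigr => j _; rewrite tlift_ten //.
split=> [y|x] c p q;
by rewrite -!scaleN1r !(tl, tr, mul, mur) !scalerDr !scalerA
           -?(mulrC c) -!scalerA comb3 ?scalerDr.
Qed.

Lemma cybe_formE V (br : V -> V -> V) n (a b : 'I_n -> V) : bilin br ->
  cybe_form br (\sum_i ten (a i) (b i)) =
  \sum_i \sum_j (ten (br (a i) (a j)) (ten (b i) (b j))
                 + ten (a i) (ten (br (b i) (a j)) (b j))
                 + ten (a i) (ten (a j) (br (b i) (b j)))).
Proof.
move=> [mul mur]; rewrite /cybe_form (lin_sum (tlift_lin _)).
have tl X Y w : linear (fun v => @ten X Y v w) by case: (ten_bilin X Y).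
have tr X Y v : linear (@ten X Y v) by case: (ten_bilin X Y).
apply: eq_bigr => i _; rewrite tlift_ten; last first.
  split=> [y|x]; apply: tlift_param_lin => v w c p q;
  by rewrite !(tl, tr, mul, mur) comb3.
rewrite (lin_sum (tlift_lin _)); apply: eq_bigr => j _; rewrite tlift_ten //.
by split=> [y|x] c p q; rewrite !(tl, tr, mul, mur) comb3.
Qed.

Definition AYBE V (mu : V -> V -> V) (r : tens V V) : Prop := aybe_form mu r = 0.

Definition CYBE V (br : V -> V -> V) (r : tens V V) : Prop := cybe_form br r = 0.

Definition PYBE V (br mu : V -> V -> V) (r : tens V V) : Prop :=
  AYBE mu r /\ CYBE br r.

End Tensors.

Section Topological.
Variable k : fieldType.
Implicit Types A U V W : vectType k.

(* The completed tensor product of V[[h]] and W[[h]] is realised as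
   (V ⊗ W)[[h]], and [hten] is its universal bilinear map. *)
Definition hten V W (v : fps V) (w : fps W) : fps (tens V W) :=
  cauchy (@ten k V W) v w.

Definition hcoef V W (t : fps (tens V W)) i j : fps k :=
  fun n => (t n : 'M[k]_(_, _)) i j.

Definition htlift V W (X : lmodType (fps k)) (f : fps V -> fps W -> X)
    (t : fps (tens V W)) : X :=
  \sum_i \sum_j hcoef t i j *: f (fcst (ebas i)) (fcst (ebas j)).

(* the canonical map  V ⊗ W -> V[[h]] ⊗^ W[[h]];  see [hat_ten] *)
Definition hat V W (t : tens V W) : fps (tens V W) := fcst t.

Lemma hten_bilin V W : bilin (@hten V W).
Proof.
case: (ten_bilin V W) => tl tr.
by split=> [w|v]; [apply: cauchy_linl|apply: cauchy_linr].
Qed.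

Lemma hat_ten V W (v : V) (w : W) : hat (ten v w) = hten (fcst v) (fcst w).
Proof.
case: (ten_bilin V W) => tl tr; apply: fpsP => n.
rewrite /hten cauchy_cstl => [|x]; last exact: (lin0 (tl x)).
by case: n => //= n; rewrite (lin0 (tr v)).
Qed.

Lemma htlift_lin V W (X : lmodType (fps k)) (f : fps V -> fps W -> X) :
  linear (htlift f).
Proof.
move=> a s t; rewrite /htlift scaler_sumr -big_split /=; apply: eq_bigr => i _.
rewrite scaler_sumr -big_split /=; apply: eq_bigr => j _.
rewrite scalerA -scalerDl; congr (_ *: _); apply: fpsP => n.
rewrite /hcoef !fpsD fpsZ !mxE summxE; congr (_ + _).
by apply: eq_bigr => m _; rewrite mxE.
Qed.

Lemma hbasE V (v : fps V) :
  v = \sum_i ((fun n => ecoord i (v n)) : fps k) *: fcst (ebas i).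
Proof.
apply: fpsP => n; rewrite fps_sum {1}(ebasE (v n)); apply: eq_bigr => i _.
by rewrite fpsZ_cst.
Qed.

Lemma htlift_ten V W (X : lmodType (fps k)) (f : fps V -> fps W -> X) :
  bilin f -> forall v w, htlift f (hten v w) = f v w.
Proof.
move=> [fl fr] v w; rewrite {2}(hbasE v) (lin_sum (fl w)); apply: eq_bigr => i _.
rewrite (linZ (fl w)) {2}(hbasE w) (lin_sum (fr _)) scaler_sumr.
apply: eq_bigr => j _; rewrite (linZ (fr _)) scalerA; congr (_ *: _).
apply: fpsP => n; rewrite /hcoef /hten /cauchy summxE.
by apply: eq_bigr => m _; rewrite mxE.
Qed.

Lemma htens_basis V W (t : fps (tens V W)) :
  t = \sum_i \sum_j hcoef t i j *: hten (fcst (ebas i)) (fcst (ebas j)).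
Proof.
apply: fpsP => n; rewrite fps_sum {1}(tens_basis (t n)); apply: eq_bigr => i _.
rewrite fps_sum; apply: eq_bigr => j _.
by rewrite -hat_ten fpsZ_cst.
Qed.

Lemma htlift_uniq V W (X : lmodType (fps k)) (f : fps V -> fps W -> X)
    (g : fps (tens V W) -> X) :
  linear g -> (forall v w, g (hten v w) = f v w) -> g =1 htlift f.
Proof.
move=> gl gf t; rewrite {1}(htens_basis t) (lin_sum gl); apply: eq_bigr => i _.
by rewrite (lin_sum gl); apply: eq_bigr => j _; rewrite (linZ gl) gf.
Qed.

Definition hjoin (A V : Type) (x : fps A * fps V) : fps (A * V) :=
  fun n => (x.1 n, x.2 n).

Definition hsplit (A V : Type) (x : fps (A * V)) : fps A * fps V :=
  (fun n => (x n).1, fun n => (x n).2).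

(* The semidirect product A_h ⋉ V_h on (A ⊕ V)_h, identified with A_h ⊕ V_h. *)
Definition hsdprod A V (muh : fps A -> fps A -> fps A)
    (lh rh : fps A -> fps V -> fps V) (x y : fps (dsum A V)) : fps (dsum A V) :=
  hjoin (sdprod muh lh rh (hsplit x) (hsplit y)).

Definition htflip V W : fps (tens V W) -> fps (tens W V) :=
  smap (@tflip k V W).

Definition hteta V W :
    fps (tens V W) -> fps (tens (dsum V W) (dsum V W)) :=
  smap (@teta k V W).

Lemma htflip_ten V W (v : fps V) (w : fps W) :
  htflip (hten v w) = hten w v.
Proof.
case: (ten_bilin W V) => tl tr; apply: fpsP => n.
rewrite /htflip /smap /hten [in RHS]cauchy_rev.
rewrite /cauchy /tflip (lin_sum (tlift_lin _)); apply: eq_bigr => i _.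
by rewrite tlift_ten.
Qed.

Lemma hteta_ten V W (v : fps V) (w : fps W) :
  hteta (hten v w) = hten (hjoin (v, 0) : fps (dsum V W)) (hjoin (0, w)).
Proof.
case: (ten_bilin (dsum V W) (dsum V W)) => tl tr; apply: fpsP => n.
rewrite /hteta /smap /hten /cauchy /teta (lin_sum (tlift_lin _)); apply: eq_bigr => i _.
rewrite tlift_ten //; split=> [y|x] a p q.
  rewrite -tl; congr ten; apply/eqP; rewrite -pair_eqE /= !eqxx /=.
  by rewrite scaler0 addr0.
rewrite -tr; congr ten; apply/eqP; rewrite -pair_eqE /= !eqxx andbT /=.
by rewrite scaler0 addr0.
Qed.

Definition hpair V (u : fps (dual V)) (v : fps V) : fps k :=
  cauchy (fun (f : dual V) (x : V) => (f : 'Hom(V, k^o)) x : k) u v.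

(* rho_h^*, with <rho_h^*(x) u, v> = - <u, rho_h(x) v>; see [hdual_repE] *)
Definition hdual_rep A V (rhoh : fps A -> fps V -> fps V)
    (x : fps A) (u : fps (dual V)) : fps (dual V) :=
  fun n => linfun (fun v : V => - hpair u (rhoh x (fcst v)) n : k^o).

Lemma hpair_bilin V : bilin (@hpair V : _ -> _ -> fps k^o).
Proof.
split=> [v|u].
  apply: (@cauchy_linl k (dual V) V k^o) => y a f g.
  by rewrite add_lfunE scale_lfunE.
by apply: (@cauchy_linr k (dual V) V k^o) => f a x y; rewrite linearP.
Qed.

Lemma hdual_repE A V (rhoh : fps A -> fps V -> fps V) x (u : fps (dual V)) v :
  linear (rhoh x) ->
  hpair (hdual_rep rhoh x u) v = - hpair u (rhoh x v).
Proof.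
move=> rl; have [pl pr] := hpair_bilin V.
have gl : linear (fun w => - hpair u (rhoh x w) : fps k^o).
  by move=> a y z; rewrite rl pr opprD scalerN.
apply: (@fps_linear_eq k V k^o (hpair (hdual_rep rhoh x u)) _ (pr _) gl) => w.
apply: fpsP => n; rewrite /hpair cauchy_cstr => [|f]; last by rewrite linear0.
rewrite linfunE // => a y z; have := gl (fcst a) (fcst y) (fcst z).
rewrite -fcstZ -fcst_is_additive => /(congr1 (fun f : fps k^o => f n)).
by rewrite fpsD fps_cstZ.
Qed.

Definition hmap_tensor A V (Th : fps V -> fps A) : fps (tens A (dual V)) :=
  \sum_i hten (Th (fcst (ebas i))) (fcst (edual i)).

(* [hmap_tensor Th] corresponds to Th under A_h ⊗^ V_h^* = Hom(V_h, A_h). *)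
Lemma hmap_tensorE A V (Th : fps V -> fps A) (v : fps V) : linear Th ->
  htlift (fun (a : fps A) (f : fps (dual V)) => hpair f v *: a) (hmap_tensor Th)
  = Th v.
Proof.
move=> Tl; have [pl pr] := hpair_bilin V.
rewrite /hmap_tensor (lin_sum (htlift_lin _)) [in RHS](hbasE v).
rewrite (lin_sum Tl); apply: eq_bigr => i _.
rewrite htlift_ten; last first.
  split=> [f a x y|a b f g]; first by rewrite scalerDr !scalerA mulrC.
  by rewrite pl scalerDl scalerA.
rewrite (linZ Tl); congr (_ *: _); apply: fpsP => n.
rewrite /hpair cauchy_cstl ?edualE // => w.
by rewrite zero_lfunE.
Qed.

Definition hskew_sym V (r : fps (tens V V)) : Prop := r + htflip r = 0.

Definition haybe_form V (muh : fps V -> fps V -> fps V) (r : fps (tens V V)) :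
    fps (tens V (tens V V)) :=
  htlift (fun a b => htlift (fun a' b' =>
      hten (muh a a') (hten b b') + hten a (hten a' (muh b b'))
      - hten a' (hten (muh a b') b)) r) r.

Lemma htlift_param_lin V W (Y X : lmodType (fps k))
    (f : Y -> fps V -> fps W -> X) (t : fps (tens V W)) :
  (forall v w, linear (fun y => f y v w)) -> linear (fun y => htlift (f y) t).
Proof.
move=> fl a x y; rewrite /htlift scaler_sumr -big_split /=.
apply: eq_bigr => i _; rewrite scaler_sumr -big_split /=.
by apply: eq_bigr => j _; rewrite fl scalerDr !scalerA mulrC.
Qed.

Lemma haybe_formE V (muh : fps V -> fps V -> fps V) n (a b : 'I_n -> fps V) :
  bilin muh ->
  haybe_form muh (\sum_i hten (a i) (b i)) =
  \sum_i \sum_j (hten (muh (a i) (a j)) (hten (b i) (b j))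
                 + hten (a i) (hten (a j) (muh (b i) (b j)))
                 - hten (a j) (hten (muh (a i) (b j)) (b i))).
Proof.
move=> [mul mur]; rewrite /haybe_form (lin_sum (htlift_lin _)).
have tl X Y w : linear (fun v => @hten X Y v w) by case: (hten_bilin X Y).
have tr X Y v : linear (@hten X Y v) by case: (hten_bilin X Y).
apply: eq_bigr => i _; rewrite htlift_ten; last first.
  split=> [y|x]; apply: htlift_param_lin => v w c p q;
  by rewrite -!scaleN1r !(tl, tr, mul, mur) !scalerDr !scalerA
             -?(mulrC c) -!scalerA comb3 ?scalerDr.
rewrite (lin_sum (htlift_lin _)); apply: eq_bigr => j _; rewrite htlift_ten //.
split=> [y|x] c p q;
by rewrite -!scaleN1r !(tl, tr, mul, mur) !scalerDr !scalerA
           -?(mulrC c) -!scalerA comb3 ?scalerDr.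
Qed.

Definition hAYBE V (muh : fps V -> fps V -> fps V) (r : fps (tens V V)) : Prop :=
  haybe_form muh r = 0.

End Topological.

Section Deformations.
Variable k : fieldType.
Variables A V : vectType k.
Implicit Types (mu br succ prec : A -> A -> A).
Implicit Types (muh succh prech : fps A -> fps A -> fps A).
Implicit Types (l r rho rhob : A -> V -> V) (lh rh : fps A -> fps V -> fps V).

(* By bilinearity it is enough to test constant series; see [reduces_toE]. *)
Definition reduces_to (X Y Z : vectType k)
    (fh : fps X -> fps Y -> fps Z) (f : X -> Y -> Z) : Prop :=
  forall x y, modh (fh (fcst x) (fcst y)) = f x y.

Lemma reduces_toE (X Y Z : vectType k) (fh : fps X -> fps Y -> fps Z) f :
  bilin fh -> reduces_to fh f ->
  forall x y, modh (fh x y) = f (modh x) (modh y).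
Proof.
move=> [fl fr] fhf x y; rewrite -fhf /modh.
rewrite (fps_linear_cont (fr x) (n := 0%N) (v := fcst (y 0%N))); last by case.
by rewrite (fps_linear_cont (fl _) (n := 0%N) (v := fcst (x 0%N))) //; case.
Qed.

Definition assoc_deformation muh mu : Prop :=
  [/\ assoc_algebra mu, assoc_algebra muh & reduces_to muh mu].

Definition dendriform_deformation succh prech succ prec : Prop :=
  [/\ dendriform_algebra succ prec, dendriform_algebra succh prech,
      reduces_to succh succ & reduces_to prech prec].

Definition qcl_op (X Y Z : vectType k) (fh gh : fps X -> fps Y -> fps Z)
    (x : X) (y : Y) : Z :=
  modh (divh (fh (fcst x) (fcst y) - gh (fcst x) (fcst y))).

(* (A, br, mu) is the quasiclassical limit of the associative deformation
   (A_h, muh) of the commutative associative algebra (A, mu). *)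
Definition quasiclassical_limit muh br mu : Prop :=
  [/\ assoc_deformation muh mu, comm_assoc_algebra mu, poisson_algebra br mu
    & forall x y, br x y = qcl_op muh (Rmul muh) x y].

(* x |> y = ((x succ_h y - y prec_h x) / h) mod h *)
Definition qcl_prelie succh prech : A -> A -> A := qcl_op succh (Rmul prech).

Definition o_operator_scalar_deformation muh lh rh (Th : fps V -> fps A)
    mu rho (T : V -> A) : Prop :=
  [/\ assoc_deformation muh mu, reduces_to lh rho /\ reduces_to rh rho,
      o_operator mu rho rho T, o_operator muh lh rh Th
    & forall v, Th v = smap T v].

(* The Poisson O-operator T is the quasiclassical limit of T_h; its Poisson
   module is the quasiclassical limit of (V_h, lh, rh). *)
Definition o_operator_qcl muh lh rh (Th : fps V -> fps A)
    br mu rhob rho (T : V -> A) : Prop :=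
  [/\ quasiclassical_limit muh br mu /\ o_operator muh lh rh Th,
      reduces_to lh rho /\ reduces_to rh rho,
      forall x v, rhob x v = qcl_op lh rh x v,
      poisson_o_operator br mu rhob rho T
    & forall v, T v = modh (Th (fcst v))].

Definition aybe_scalar_deformation muh (r_h : fps (tens A A))
    mu (r : tens A A) : Prop :=
  [/\ assoc_deformation muh mu, AYBE mu r, hAYBE muh r_h & r_h = hat r].

Definition pybe_qcl muh (r_h : fps (tens A A)) br mu (r : tens A A) : Prop :=
  [/\ quasiclassical_limit muh br mu, hAYBE muh r_h, PYBE br mu r
    & r = modh r_h].

End Deformations.

(* Main.v *)
Require Import Defs.
From HB Require Import structures.
From mathcomp Require Import all_boot all_order all_algebra.
From mathcomp Require Import boolp.

(* The operation x >_h y - y <_h x of a dendriform algebra is pre-Lie and is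
   compatible with the dendriform operations; over k[[h]] it is divisible by h,
   and its quotient by h still satisfies these identities because h is a
   nonzerodivisor. Reducing mod h gives the pre-Poisson algebra, and the same
   argument applied to commutators turns any associative deformation of a
   commutative algebra into a Poisson algebra. Applied to the semidirect products
   of A_h by its bimodule and by the dual bimodule, this gives all the limits.

   The tensor r solves the AYBE in the double of any two bilinear operations,
   dendriform or not. As C(r) = A(r) for a skew-symmetric product, and the
   bracket of the double is the product of the double of x |> y and - y |> x,
   the same computation solves the CYBE. *)

Set Implicit Arguments.
Unset Strict Implicit.
Unset Printing Implicit Defensive.

Import GRing.Theory.
Local Open Scope ring_scope.

(** * Calculus of bilinear maps over a commutative ring *)

Section Bilinear.
Variable S : comNzRingType.
Implicit Types U V W X : lmodType S.

Lemma linN U V (f : U -> V) : linear f -> {morph f : x / - x}.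
Proof. by move=> fl x; rewrite -!scaleN1r (linZ fl). Qed.

Section BilinearMap.
Variables (U V W : lmodType S) (f : U -> V -> W).
Hypothesis fb : bilin f.

Lemma bilinDl x y z : f (x + y) z = f x z + f y z.
Proof. exact: (linD (fb.1 z)). Qed.

Lemma bilinDr x y z : f x (y + z) = f x y + f x z.
Proof. exact: (linD (fb.2 x)). Qed.

Lemma bilin0l z : f 0 z = 0.
Proof. exact: (lin0 (fb.1 z)). Qed.

Lemma bilin0r x : f x 0 = 0.
Proof. exact: (lin0 (fb.2 x)). Qed.

Lemma bilinNl x z : f (- x) z = - f x z.
Proof. exact: (linN (fb.1 z)). Qed.

Lemma bilinNr x y : f x (- y) = - f x y.
Proof. exact: (linN (fb.2 x)). Qed.

Lemma bilinBl x y z : f (x - y) z = f x z - f y z.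
Proof. by rewrite bilinDl bilinNl. Qed.

Lemma bilinBr x y z : f x (y - z) = f x y - f x z.
Proof. by rewrite bilinDr bilinNr. Qed.

Lemma bilinZl a x z : f (a *: x) z = a *: f x z.
Proof. exact: (linZ (fb.1 z)). Qed.

Lemma bilinZr a x y : f x (a *: y) = a *: f x y.
Proof. exact: (linZ (fb.2 x)). Qed.

End BilinearMap.

Lemma bilin_add U V W (f g : U -> V -> W) :
  bilin f -> bilin g -> bilin (fun x y => f x y + g x y).
Proof.
move=> fb gb; split=> [y|x] a u v.
  rewrite (bilinDl fb) (bilinZl fb) (bilinDl gb) (bilinZl gb).
  by rewrite scalerDr addrACA.
rewrite (bilinDr fb) (bilinZr fb) (bilinDr gb) (bilinZr gb).
by rewrite scalerDr addrACA.
Qed.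

Lemma bilin_opp U V W (f : U -> V -> W) :
  bilin f -> bilin (fun x y => - f x y).
Proof.
move=> fb; split=> [y|x] a u v.
  by rewrite (bilinDl fb) (bilinZl fb) opprD scalerN.
by rewrite (bilinDr fb) (bilinZr fb) opprD scalerN.
Qed.

Lemma bilin_flip U V W (f : U -> V -> W) :
  bilin f -> bilin (fun y x => f x y).
Proof. by case. Qed.

End Bilinear.

(** * Bimodules and semidirect products *)

Section Bimodules.
Variables (S : comNzRingType) (A V : lmodType S).
Implicit Types (mu : A -> A -> A) (l r : A -> V -> V).

(* Stronger than the second half of [bimodule], where l and r may be shifted by
   opposite constants. *)
Definition bimodule_laws mu l r : Prop :=
  [/\ bilin l, bilin r,
      forall x y v, l (mu x y) v = l x (l y v),
      forall x y v, r y (l x v) = l x (r y v)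
    & forall x y v, r y (r x v) = r (mu x y) v].

Lemma sdprod_bilin mu l r : bilin mu -> bilin l -> bilin r ->
  bilin (sdprod mu l r : A * V -> A * V -> A * V).
Proof.
move=> mb lb rb; split=> [[y v]|[x u]] a [x' u'] [y' v']; congr pair => /=.
- by rewrite (bilinDl mb) (bilinZl mb).
- rewrite (bilinDl lb) (bilinZl lb) (bilinDr rb) (bilinZr rb).
  by rewrite scalerDr addrACA.
- by rewrite (bilinDr mb) (bilinZr mb).
rewrite (bilinDr lb) (bilinZr lb) (bilinDl rb) (bilinZl rb).
by rewrite scalerDr addrACA.
Qed.

Lemma bimodule_lawsP mu l r :
  assoc_algebra mu -> bimodule_laws mu l r -> bimodule mu l r.
Proof.
move=> [mb ma] [lb rb ll lr rr]; split; first by [].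
split; first exact: sdprod_bilin.
move=> [x u] [y v] [z w]; congr pair => /=; first exact: ma.
by rewrite (bilinDr lb) (bilinDr rb) ll lr rr addrA.
Qed.

End Bimodules.

(** * Identities for x ≻ y - y ≺ x in a dendriform algebra, before any division by h *)

Section Dendriform.
Variables (S : comNzRingType) (A : lmodType S) (succ prec : A -> A -> A).
Hypothesis D : dendriform_algebra succ prec.

(** Associativity is the sum of the three dendriform axioms. *)
Lemma dendriform_assoc : assoc_algebra (dsum_op succ prec).
Proof.
have [sb pb pp sp ss] := D; split; first exact: bilin_add.
move=> x y z; rewrite [LHS]/dsum_op [RHS]/dsum_op -pp ss /dsum_op.
by rewrite (bilinDr sb) (bilinDl pb) sp addrA.
Qed.

Lemma dendriform_bimodule_laws :
  bimodule_laws (dsum_op succ prec) (Lmul succ) (Rmul prec).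
Proof.
have [sb pb pp sp ss] := D; split=> [|||x y v|x y v].
- exact: sb.
- exact: (bilin_flip pb).
- exact: ss.
- exact: sp.
exact: pp.
Qed.

Lemma dendriform_o_operator :
  o_operator (dsum_op succ prec) (Lmul succ) (Rmul prec) (fun x : A => x).
Proof.
split=> [|//|u v].
  exact: bimodule_lawsP dendriform_assoc dendriform_bimodule_laws.
by rewrite /dsum_op addrC.
Qed.

(** The pre-Lie product of a dendriform algebra; over k[[h]] it is the numerator of the limit
    operation. *)
Let T x y := succ x y - prec y x.

(** This is why the commutator of the limit pre-Lie product is the limit Poisson bracket. *)
Lemma dendriform_commutator x y :
  dsum_op succ prec x y - dsum_op succ prec y x = T x y - T y x.
Proof.
by rewrite /T /dsum_op opprD opprB [RHS]addrACA [prec x y + _]addrC.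
Qed.

(** Source of the pre-Poisson relation for x ▷ (y ≻ z), once divided by h. *)
Lemma dendriform_commutator_act x y z :
  T x (succ y z) = succ y (T x z)
    + succ (dsum_op succ prec x y - dsum_op succ prec y x) z.
Proof.
have [sb pb pp sp ss] := D.
rewrite (bilinBl sb) /T (bilinBr sb) !ss sp.
by rewrite [RHS]addrC addrA subrK.
Qed.

(** The mixed terms x ≻ (z ≺ y) and (x ≻ z) ≺ y cancel by the middle axiom. Divided by h, this
    becomes the pre-Poisson relation for (x ∘ y) ▷ z. *)
Lemma dendriform_prod_act x y z :
  T (dsum_op succ prec x y) z = succ x (T y z) + prec (T x z) y.
Proof.
have [sb pb pp sp ss] := D.
by rewrite /T (bilinBr sb) (bilinBl pb) -pp ss sp addrA subrK.
Qed.

Lemma dendriform_prelie x y z :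
  T (T x y) z - T x (T y z) = T (T y x) z - T y (T x z).
Proof.
have [sb pb pp sp ss] := D.
have TB u v w : T (u - v) w = T u w - T v w.
  by rewrite /T (bilinBl sb) (bilinBr pb) !opprD opprK addrACA.
(* [T] and the associative product have the same commutator, so the difference of the nested terms
   can be expanded by [dendriform_prod_act]. *)
have {TB}-> : T (T x y) z = T (T y x) z
    + (T (dsum_op succ prec x y) z - T (dsum_op succ prec y x) z).
  by rewrite -TB dendriform_commutator (TB (T x y)) addrC subrK.
rewrite !dendriform_prod_act -!addrA; congr (_ + _).
(* The terms in [T y z] now cancel, and those in [T x z] add up to [- T y (T x z)]. *)
rewrite [T x (T y z)]/T [T y (T x z)]/T !opprD !opprK !addrA.
rewrite -!addrA [succ x _ + _]addrC -!addrA; congr (_ + _).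
by rewrite [- prec (T y z) x + _]addrA -opprD addNr addr0 addrC.
Qed.

End Dendriform.

(** * Division by h *)

Section DivisionByH.
Variable k : comNzRingType.
Implicit Types U V W : lmodType k.

(** Identities for quotients by h are all proved by multiplying by h and cancelling it here. *)
Lemma hvar_inj U (u v : fps U) : hvar k *: u = hvar k *: v -> u = v.
Proof.
move=> uv; apply: fpsP => n.
by have := congr1 (fun w : fps U => w n.+1) uv; rewrite !hvarZ.
Qed.

Lemma modhD U (u v : fps U) : modh (u + v) = modh u + modh v.
Proof. exact: fpsD. Qed.

Lemma modhN U (u : fps U) : modh (- u) = - modh u.
Proof. exact: fpsN. Qed.

Lemma modh_cstZ U (a : k) (u : fps U) : modh (fcst a *: u) = a *: modh u.
Proof. exact: fps_cstZ. Qed.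

Lemma divh_bilin U V W (f : fps U -> fps V -> fps W) :
  bilin f -> (forall x y, modh (f x y) = 0) -> bilin (fun x y => divh (f x y)).
Proof.
move=> fb f0; split=> [y|x] a u v; apply: hvar_inj;
  rewrite scalerDr [hvar k *: (a *: _)]scalerA mulrC -scalerA !divhK //.
  by rewrite (bilinDl fb) (bilinZl fb).
by rewrite (bilinDr fb) (bilinZr fb).
Qed.

End DivisionByH.

(** * Reduction mod h of operations and of their difference quotients *)

Section Reduction.
Variable k : fieldType.
Implicit Types X Y Z W : vectType k.

Lemma reduces_to_bilin X Y Z (fh : fps X -> fps Y -> fps Z) (f : X -> Y -> Z) :
  bilin fh -> reduces_to fh f -> bilin f.
Proof.
move=> fb ff; split=> [y|x] a u v; rewrite -!ff fcst_is_additive fcstZ.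
  by rewrite (bilinDl fb) (bilinZl fb) modhD modh_cstZ.
by rewrite (bilinDr fb) (bilinZr fb) modhD modh_cstZ.
Qed.

Lemma reduces_to_assoc X (muh : fps X -> fps X -> fps X) (mu : X -> X -> X) :
  assoc_algebra muh -> reduces_to muh mu -> assoc_algebra mu.
Proof.
move=> [mb ma] mm; split; first exact: (reduces_to_bilin mb mm).
(* Each element is by definition the reduction of its constant series; folding it so lets nested
   products be lifted to k[[h]]. *)
move=> x y z; rewrite -(mm y z) -(mm x y) -[x in LHS]/(modh (fcst x)).
by rewrite -[z in RHS]/(modh (fcst z)) -!(reduces_toE mb mm) ma.
Qed.

(** Two operations with the same reduction differ by a multiple of h. The quotient [d] is later
    known only through h d = fh - gh, and bilinearity extends the limit from constant series to all
    series. *)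
Lemma quotient_exists X Y Z (fh gh : fps X -> fps Y -> fps Z) (f : X -> Y -> Z) :
  bilin fh -> bilin gh -> reduces_to fh f -> reduces_to gh f ->
  exists d : fps X -> fps Y -> fps Z,
    [/\ bilin d, forall x y, hvar k *: d x y = fh x y - gh x y
      & forall x y, qcl_op fh gh (modh x) (modh y) = modh (d x y)].
Proof.
move=> fb gb ff gf; pose d x y := divh (fh x y - gh x y).
have fg x y : modh (fh x y - gh x y) = 0.
  by rewrite modhD modhN (reduces_toE fb ff) (reduces_toE gb gf) subrr.
have db : bilin d by apply: divh_bilin => //; apply/bilin_add/bilin_opp.
exists d; split=> // x y; first exact: divhK.
have dq : reduces_to d (qcl_op fh gh) by [].
by rewrite (reduces_toE db dq).
Qed.

End Reduction.

(** * The Poisson algebra of an associative deformation *)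

Section QuasiclassicalPoisson.
Variables (k : fieldType) (A : vectType k).
Variables (muh : fps A -> fps A -> fps A) (mu : A -> A -> A).
Hypotheses (muhA : assoc_algebra muh) (muh_mu : reduces_to muh mu).
Hypothesis muC : commutative mu.

Let mb : bilin muh := muhA.1.

Let opb : bilin (Rmul muh). Proof. exact: bilin_flip mb. Qed.

Let op_mu : reduces_to (Rmul muh) mu.
Proof. by move=> x y; rewrite muC -muh_mu. Qed.

Variable d : fps A -> fps A -> fps A.
Hypotheses (db : bilin d) (dK : forall x y, hvar k *: d x y = muh x y - muh y x).

Let dC x y : d x y = - d y x.
Proof. by apply: hvar_inj; rewrite scalerN !dK opprB. Qed.

(** A commutator acts by derivations of an associative product. *)
Let d_mu x y z : d x (muh y z) = muh (d x y) z + muh y (d x z).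
Proof.
apply: hvar_inj; rewrite scalerDr -(bilinZl mb) -(bilinZr mb) !dK.
by rewrite (bilinBl mb) (bilinBr mb) !muhA.2 addrA subrK.
Qed.

(** The Jacobi identity in Leibniz form: one factor h turns the inner bracket into a commutator of
    products, on which [d x] is a derivation. *)
Let d_d x y z : d x (d y z) = d (d x y) z + d y (d x z).
Proof.
apply: hvar_inj; rewrite scalerDr [in RHS]dK [hvar k *: d y _]dK.
rewrite -(bilinZr db) dK (bilinBr db) !d_mu.
rewrite opprD [- _ + - _]addrC addrACA; congr (_ + _).
Qed.

Variable br : A -> A -> A.
Hypothesis brE : forall x y, br (modh x) (modh y) = modh (d x y).

Let br_d : reduces_to d br.
Proof. by move=> x y; rewrite -brE. Qed.

Lemma quotient_poisson : poisson_algebra br mu.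
Proof.
have mulA := reduces_to_assoc muhA muh_mu.
have brb : bilin br by exact: (reduces_to_bilin db br_d).
have brC x y : br x y = - br y x by rewrite -!br_d dC modhN.
split; [split=> // [x|x y z] | by [] | move=> x y z].
- rewrite -br_d; have -> : d (fcst x) (fcst x) = 0; last by [].
  by apply: hvar_inj; rewrite dK subrr scaler0.
- rewrite [br z (br x y)]brC [br z x]brC (bilinNr brb).
  rewrite -[x]/(modh (fcst x)) -[y]/(modh (fcst y)) -[z]/(modh (fcst z)) !brE.
  by rewrite d_d modhD addrK subrr.
rewrite -[x]/(modh (fcst x)) -[y]/(modh (fcst y)) -[z]/(modh (fcst z)) !brE.
by rewrite -!(reduces_toE mb muh_mu) brE d_mu modhD.
Qed.

End QuasiclassicalPoisson.

(** Commutativity of [mu] makes the opposite product reduce to [mu] too, so commutators are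
    divisible by h. *)
Lemma quasiclassical_limitP (k : fieldType) (A : vectType k)
    (muh : fps A -> fps A -> fps A) (mu : A -> A -> A) :
  assoc_algebra muh -> reduces_to muh mu -> commutative mu ->
  quasiclassical_limit muh (qcl_op muh (Rmul muh)) mu.
Proof.
move=> muhA muh_mu muC; have mulA := reduces_to_assoc muhA muh_mu.
have opb : bilin (Rmul muh) by apply: bilin_flip muhA.1.
have op_mu : reduces_to (Rmul muh) mu by move=> x y; rewrite muC -muh_mu.
have [d [db dK dE]] := quotient_exists muhA.1 opb muh_mu op_mu.
by split=> //; apply: (quotient_poisson muhA muh_mu muC db dK dE).
Qed.

(** * The pre-Poisson algebra of a dendriform deformation *)

Section QuotientPrePoisson.
Variables (k : fieldType) (A : vectType k) (succ : A -> A -> A).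
Variables (succh prech : fps A -> fps A -> fps A).
Hypothesis deform : dendriform_deformation succh prech succ (Rmul succ).

Let circh := dsum_op succh prech.
Let circ := zinbiel_prod succ.
Variable tri : A -> A -> A.

Let D : dendriform_algebra succh prech. Proof. by case: deform. Qed.
Let sb : bilin succh. Proof. by case: D. Qed.
Let pb : bilin prech. Proof. by case: D. Qed.
Let s_succ : reduces_to succh succ. Proof. by case: deform. Qed.

Lemma prec_reduces : reduces_to (Rmul prech) succ.
Proof. by case: deform => _ _ _ pr x y; apply: pr. Qed.

Lemma circ_reduces : reduces_to circh circ.
Proof.
case: deform => _ _ _ pr x y.
by rewrite /circh /dsum_op modhD s_succ pr addrC.
Qed.

Let opb : bilin (Rmul prech). Proof. exact: bilin_flip pb. Qed.

Variable T : fps A -> fps A -> fps A.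
Hypotheses (Tb : bilin T).
Hypothesis TK : forall x y, hvar k *: T x y = succh x y - prech y x.
Hypothesis triE : forall x y, tri (modh x) (modh y) = modh (T x y).

Let circb : bilin circh. Proof. exact: (dendriform_assoc D).1. Qed.
Let succE x y : modh (succh x y) = succ (modh x) (modh y).
Proof. exact: reduces_toE. Qed.
Let precE x y : modh (prech x y) = succ (modh y) (modh x).
Proof. exact: (reduces_toE opb prec_reduces). Qed.
Let circE x y : modh (circh x y) = circ (modh x) (modh y).
Proof. exact: (reduces_toE circb circ_reduces). Qed.

Let T_T x y z : T (T x y) z - T x (T y z) = T (T y x) z - T y (T x z).
Proof.
(* The identity is quadratic in [T], so each term absorbs two factors h. *)
do 2!apply: hvar_inj; rewrite !scalerBr.
do !rewrite -[hvar k *: T (T _ _) _](bilinZl Tb).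
do !rewrite -[hvar k *: T _ (T _ _)](bilinZr Tb).
rewrite !TK; exact: (dendriform_prelie D).
Qed.

Let T_circ x y z : T (circh x y) z = succh x (T y z) + prech (T x z) y.
Proof.
apply: hvar_inj; rewrite scalerDr -(bilinZr sb) -(bilinZl pb) !TK.
exact: (dendriform_prod_act D).
Qed.

Let T_succ x y z : T x (succh y z) = succh y (T x z) + succh (T x y - T y x) z.
Proof.
apply: hvar_inj; rewrite scalerDr -(bilinZr sb) -(bilinZl sb) scalerBr !TK.
by rewrite -(dendriform_commutator succh prech) -(dendriform_commutator_act D).
Qed.

Lemma quotient_prepoisson : prepoisson_algebra tri succ.
Proof.
split; first by case: deform.
- split; first by apply: (reduces_to_bilin Tb) => x y; rewrite -triE.
  move=> x y z.
  rewrite -[x]/(modh (fcst x)) -[y]/(modh (fcst y)) -[z]/(modh (fcst z)) !triE.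
  by rewrite -!modhN -!modhD T_T.
- move=> x y z.
  rewrite -[x]/(modh (fcst x)) -[y]/(modh (fcst y)) -[z]/(modh (fcst z)).
  (* [prech (T x z) y] reduces to y ≻ (x ▷ z), since mod h the operation ≺ is the opposite of ≻. *)
  by rewrite -[zinbiel_prod _ _ _]circE !triE T_circ modhD succE precE.
move=> x y z; rewrite /commutator.
rewrite -[x]/(modh (fcst x)) -[y]/(modh (fcst y)) -[z]/(modh (fcst z)).
by rewrite -succE !triE T_succ modhD !succE modhD modhN.
Qed.

(** Multiplied by h, both sides lift to the commutator of [circh]. *)
Lemma quotient_commutator : commutator tri = qcl_op circh (Rmul circh).
Proof.
apply/funext => x; apply/funext => y; rewrite /qcl_op.
rewrite /commutator -[x in LHS]/(modh (fcst x)) -[y in LHS]/(modh (fcst y)) !triE.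
rewrite -modhN -modhD; congr modh; apply: hvar_inj; rewrite scalerBr !TK.
rewrite -(dendriform_commutator succh prech) divhK // modhD modhN.
by rewrite /Rmul !circE /circ /zinbiel_prod [X in _ - X]addrC subrr.
Qed.

End QuotientPrePoisson.

Section QuasiclassicalPrePoisson.
Variables (k : fieldType) (A : vectType k) (succ : A -> A -> A).
Variables (succh prech : fps A -> fps A -> fps A).
Hypothesis deform : dendriform_deformation succh prech succ (Rmul succ).

Let T_exists : exists T : fps A -> fps A -> fps A,
  [/\ bilin T, forall x y, hvar k *: T x y = succh x y - prech y x
    & forall x y, qcl_prelie succh prech (modh x) (modh y) = modh (T x y)].
Proof.
have [_ [sb pb _ _ _] s_succ _] := deform.
exact: quotient_exists sb (bilin_flip pb) s_succ (prec_reduces deform).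
Qed.

Lemma qcl_prelie_prepoisson : prepoisson_algebra (qcl_prelie succh prech) succ.
Proof.
by have [T [Tb TK TE]] := T_exists; exact: (quotient_prepoisson deform Tb TK TE).
Qed.

Lemma commutator_qcl_prelie :
  commutator (qcl_prelie succh prech)
  = qcl_op (dsum_op succh prech) (Rmul (dsum_op succh prech)).
Proof.
by have [T [Tb TK TE]] := T_exists; exact: (quotient_commutator deform TK TE).
Qed.

End QuasiclassicalPrePoisson.

(** * Semidirect products over k[[h]] and their limits *)

Section TopologicalSemidirectProduct.
Variable k : fieldType.
Implicit Types A V : vectType k.

Lemma hjoin_linear A V a (x y : fps A * fps V) :
  hjoin (a *: x + y) = a *: hjoin x + hjoin y :> fps (dsum A V).
Proof.
apply: fpsP => n; apply: injective_projections;
  by rewrite !fpsD /= !fpsZ !raddf_sum.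
Qed.

Lemma hsplit_linear A V a (x y : fps (dsum A V)) :
  hsplit (a *: x + y) = a *: (hsplit x : fps A * fps V) + hsplit y.
Proof.
congr pair; apply: fpsP => n; rewrite !fpsD /=; congr (_ + _);
  by rewrite !fpsZ raddf_sum.
Qed.

Lemma hsplit_cst A V (x : dsum A V) :
  hsplit (fcst x) = (fcst x.1, fcst x.2) :> fps A * fps V.
Proof. by congr pair; apply: fpsP => -[|n]. Qed.

Lemma hjoinK A V (x : fps A * fps V) : hsplit (hjoin x) = x.
Proof. by case: x. Qed.

Section Product.
Variables (A V : vectType k).
Variables (muh : fps A -> fps A -> fps A) (lh rh : fps A -> fps V -> fps V).
Variables (mu : A -> A -> A) (l r : A -> V -> V).

Lemma hsdprod_bilin :
  bilin muh -> bilin lh -> bilin rh -> bilin (hsdprod muh lh rh).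
Proof.
move=> mb lb rb; have sb := sdprod_bilin mb lb rb.
by split=> [y|x] a u v; rewrite /hsdprod hsplit_linear;
   rewrite ?(bilinDl sb) ?(bilinDr sb) ?(bilinZl sb) ?(bilinZr sb) hjoin_linear.
Qed.

Lemma hsdprod_assoc :
  assoc_algebra muh -> bimodule_laws muh lh rh ->
  assoc_algebra (hsdprod muh lh rh).
Proof.
move=> mA laws; have [mb _] := mA; have [lb rb _ _ _] := laws.
have [_ [_ sA]] := bimodule_lawsP mA laws.
split; first exact: hsdprod_bilin.
by move=> x y z; rewrite /hsdprod !hjoinK sA.
Qed.

Lemma hsdprod_reduces :
  reduces_to muh mu -> reduces_to lh l -> reduces_to rh r ->
  reduces_to (hsdprod muh lh rh) (sdprod mu l r : dsum A V -> _).
Proof.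
move=> mm ll rr x y; rewrite /hsdprod !hsplit_cst.
by congr pair; [rewrite -mm | rewrite -ll -rr].
Qed.

(** In the module component the commutator groups into (l - r)(x) v - (l - r)(y) u, so the Poisson
    action is the limit of l - r. *)
Lemma hsdprod_qcl_op :
  qcl_op (hsdprod muh lh rh) (Rmul (hsdprod muh lh rh))
  = sdbracket (qcl_op muh (Rmul muh)) (qcl_op lh rh) :> (dsum A V -> _).
Proof.
apply/funext => x; apply/funext => y; rewrite /qcl_op /Rmul /hsdprod !hsplit_cst.
congr pair; rewrite /modh /divh /= !fpsD !fpsN // opprD opprB [RHS]addrACA.
by rewrite [- _ + _]addrC.
Qed.

End Product.

(** Applied to the dual bimodule it gives part (1); applied to A_h itself it gives the Poisson
    module of the limit O-operator. *)
Lemma hsdprod_quasiclassical_limit A V (muh : fps A -> fps A -> fps A)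
    (lh rh : fps A -> fps V -> fps V) (mu : A -> A -> A) (rho : A -> V -> V) :
  assoc_algebra muh -> bimodule_laws muh lh rh -> commutative mu ->
  reduces_to muh mu -> reduces_to lh rho -> reduces_to rh rho ->
  quasiclassical_limit (hsdprod muh lh rh)
    (sdbracket (qcl_op muh (Rmul muh)) (qcl_op lh rh))
    (sdprod mu rho rho : dsum A V -> _).
Proof.
move=> mA laws muC mm ll rr; rewrite -hsdprod_qcl_op.
apply: quasiclassical_limitP; first exact: hsdprod_assoc.
  exact: hsdprod_reduces.
by move=> x y; congr pair => /=; [rewrite muC | rewrite addrC].
Qed.

End TopologicalSemidirectProduct.

(** * Dual bimodules over k[[h]] *)

Section TopologicalDual.
Variable k : fieldType.
Implicit Types A V : vectType k.

Lemma hpair_cst V (u : fps (dual V)) (v : V) n :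
  hpair u (fcst v) n = (u n : 'Hom(V, k^o)) v.
Proof. by rewrite /hpair cauchy_cstr // => f; rewrite linear0. Qed.

(** Pairing with constant vectors reads off every coefficient, so identities of dual actions can be
    tested by the pairing. *)
Lemma hpair_inj V (u v : fps (dual V)) :
  (forall w, hpair u w = hpair v w) -> u = v.
Proof.
move=> uv; apply: fpsP => n; apply/lfunP => x.
by rewrite -!hpair_cst uv.
Qed.

Lemma hdual_rep_coef A V (rhoh : fps A -> fps V -> fps V) x u n (v : V) :
  bilin rhoh ->
  (hdual_rep rhoh x u n : 'Hom(V, k^o)) v = - hpair u (rhoh x (fcst v)) n.
Proof. by move=> rb; rewrite -hpair_cst (hdual_repE _ _ (rb.2 x)). Qed.

Lemma hdual_rep_bilin A V (rhoh : fps A -> fps V -> fps V) :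
  bilin rhoh -> bilin (hdual_rep rhoh).
Proof.
move=> rb; have pb := hpair_bilin V.
split=> [u|x] a y z; apply: hpair_inj => w;
  rewrite (bilinDl pb) (bilinZl pb) !hdual_repE; try exact: rb.2.
  by rewrite (bilinDl rb) (bilinZl rb) (bilinDr pb) (bilinZr pb) opprD scalerN.
by rewrite (bilinDl pb) (bilinZl pb) opprD scalerN.
Qed.

Lemma hpair_opp_dual A V (rhoh : fps A -> fps V -> fps V) x u w :
  bilin rhoh -> hpair (opp_rep (hdual_rep rhoh) x u) w = hpair u (rhoh x w).
Proof.
move=> rb; rewrite (bilinNl (hpair_bilin V)) hdual_repE ?opprK //; exact: rb.2.
Qed.

(** The two signs cancel, so these actions are plain transposes; transposition reverses composition
    and hence exchanges left and right. *)
Lemma hdual_bimodule_laws A V (muh : fps A -> fps A -> fps A)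
    (lh rh : fps A -> fps V -> fps V) :
  bimodule_laws muh lh rh ->
  bimodule_laws muh (opp_rep (hdual_rep rh)) (opp_rep (hdual_rep lh)).
Proof.
move=> [lb rb ll lr rr]; split=> [||x y u|x y u|x y u].
- exact: bilin_opp (hdual_rep_bilin rb).
- exact: bilin_opp (hdual_rep_bilin lb).
- by apply: hpair_inj => w; rewrite !hpair_opp_dual // rr.
- by apply: hpair_inj => w; rewrite !hpair_opp_dual // lr.
by apply: hpair_inj => w; rewrite !hpair_opp_dual // ll.
Qed.

Lemma hdual_rep_reduces A V (rhoh : fps A -> fps V -> fps V) (rho : A -> V -> V) :
  bilin rhoh -> reduces_to rhoh rho ->
  reduces_to (hdual_rep rhoh) (dual_rep rho).
Proof.
move=> rb rr x u; have rhob := reduces_to_bilin rb rr.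
apply/lfunP => v; rewrite hdual_rep_coef // dual_repE; last exact: rhob.2.
by rewrite /hpair cauchy_cstl -?rr // => w; rewrite zero_lfunE.
Qed.

Lemma opp_rep_reduces A V (rhoh : fps A -> fps V -> fps V) (rho : A -> V -> V) :
  reduces_to rhoh rho -> reduces_to (opp_rep rhoh) (opp_rep rho).
Proof. by move=> rr x v; rewrite /opp_rep modhN rr. Qed.

Lemma hdual_qcl_op A V (lh rh : fps A -> fps V -> fps V) (rho : A -> V -> V) :
  bilin lh -> bilin rh -> reduces_to lh rho -> reduces_to rh rho ->
  qcl_op (opp_rep (hdual_rep rh)) (opp_rep (hdual_rep lh))
  = dual_rep (qcl_op lh rh).
Proof.
move=> lb rb ll rr; apply/funext => x; apply/funext => u; apply/lfunP => v.
(* [d] only serves to show that the limit operation is linear, as [dual_repE] asks. *)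
have [d [db _ dE]] := quotient_exists lb rb ll rr.
have dq : reduces_to d (qcl_op lh rh) by move=> y w; rewrite -dE.
rewrite dual_repE; last exact: (reduces_to_bilin db dq).2.
rewrite /qcl_op /modh /divh /opp_rep !fpsD !fpsN opprK addrC.
rewrite add_lfunE opp_lfunE !hdual_rep_coef // /hpair.
have u0 w : (0 : 'Hom(V, k^o)) w = 0 by rewrite zero_lfunE.
by rewrite !cauchy_cstl // linearB opprB opprK addrC.
Qed.

End TopologicalDual.

(** * The Yang-Baxter computation in terms of structure constants *)

Section StructureConstants.
Variables (S : comNzRingType) (B X : lmodType S) (n : nat).
(** [t] stands for x ⊗ (y ⊗ z), [E] and [F] for a basis of A and its dual basis, [p] and [s] for the
    structure constants of ≺ and ≻. In [muEF] and [muFE] the same constants appear transposed. *)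
Variables (mu : B -> B -> B) (t : B -> B -> B -> X).
Hypothesis mb : bilin mu.
Hypothesis t1 : forall y z, linear (fun x => t x y z).
Hypothesis t2 : forall x z, linear (fun y => t x y z).
Hypothesis t3 : forall x y, linear (fun z => t x y z).
Variables (E F : 'I_n -> B) (s p : 'I_n -> 'I_n -> 'I_n -> S).
Hypothesis muEE : forall i j, mu (E i) (E j) = \sum_l (p i j l + s i j l) *: E l.
Hypothesis muEF : forall i j, mu (E i) (F j) = \sum_l p l i j *: F l.
Hypothesis muFE : forall i j, mu (F j) (E i) = \sum_l s i l j *: F l.
Hypothesis muFF : forall i j, mu (F i) (F j) = 0.

Let sum1 (c : 'I_n -> S) f y z :
  t (\sum_l c l *: f l) y z = \sum_l c l *: t (f l) y z.
Proof.
apply: etrans (lin_sum (t1 y z) _ _ _) _; apply: eq_bigr => l _.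
exact: (linZ (t1 y z)).
Qed.

Let sum2 (c : 'I_n -> S) f x z :
  t x (\sum_l c l *: f l) z = \sum_l c l *: t x (f l) z.
Proof.
apply: etrans (lin_sum (t2 x z) _ _ _) _; apply: eq_bigr => l _.
exact: (linZ (t2 x z)).
Qed.

Let sum3 (c : 'I_n -> S) f x y :
  t x y (\sum_l c l *: f l) = \sum_l c l *: t x y (f l).
Proof.
apply: etrans (lin_sum (t3 x y) _ _ _) _; apply: eq_bigr => l _.
exact: (linZ (t3 x y)).
Qed.

(** Splits the constants of ∘ into those of ≺ and ≻, with the indices cycled into the patterns of
    [muEF] and [muFE]. *)
Let rotate (u : 'I_n -> 'I_n -> 'I_n -> X) :
  \sum_i \sum_j \sum_l (p i j l + s i j l) *: u i j l
  = \sum_i \sum_j \sum_l p l i j *: u l i j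
    + \sum_i \sum_j \sum_l s j l i *: u j l i.
Proof.
have -> : \sum_i \sum_j \sum_l p l i j *: u l i j
          = \sum_i \sum_j \sum_l p i j l *: u i j l.
  by rewrite [RHS]exchange_big; apply: eq_bigr => i _; rewrite exchange_big.
have -> : \sum_i \sum_j \sum_l s j l i *: u j l i
          = \sum_i \sum_j \sum_l s i j l *: u i j l.
  by rewrite exchange_big; apply: eq_bigr => i _; rewrite exchange_big.
rewrite -big_split; apply: eq_bigr => i _; rewrite -big_split.
apply: eq_bigr => j _; rewrite -big_split; apply: eq_bigr => l _.
exact: scalerDl.
Qed.

Let eq_sum2 (f g : 'I_n -> 'I_n -> X) :
  (forall i j, f i j = g i j) -> \sum_i \sum_j f i j = \sum_i \sum_j g i j.
Proof. by move=> fg; apply: eq_bigr => i _; apply: eq_bigr. Qed.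

(** Invariance of the canonical tensor: a product of two [E] in one slot becomes a product of [E]
    with [F] in the cyclically next slot plus one of [F] with [E] in the slot after. The next two
    statements start from the other slots. *)
Let cycle1 : \sum_i \sum_j t (mu (E i) (E j)) (F i) (F j)
  = \sum_i \sum_j t (E j) (mu (E i) (F j)) (F i)
    + \sum_i \sum_j t (E i) (F j) (mu (F i) (E j)).
Proof.
have := rotate (fun i j l => t (E l) (F i) (F j)) => rot.
apply: etrans (eq_trans rot _); first by apply: eq_sum2 => i j; rewrite muEE sum1.
congr (_ + _); apply: eq_sum2 => i j; first by rewrite muEF sum2.
by rewrite muFE sum3.
Qed.

Let cycle2 : \sum_i \sum_j t (F j) (mu (E i) (E j)) (F i)
  = \sum_i \sum_j t (F i) (E j) (mu (E i) (F j))
    + \sum_i \sum_j t (mu (F i) (E j)) (E i) (F j).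
Proof.
have := rotate (fun i j l => t (F j) (E l) (F i)) => rot.
apply: etrans (eq_trans rot _); first by apply: eq_sum2 => i j; rewrite muEE sum2.
congr (_ + _); apply: eq_sum2 => i j; first by rewrite muEF sum3.
by rewrite muFE sum1.
Qed.

Let cycle3 : \sum_i \sum_j t (F i) (F j) (mu (E i) (E j))
  = \sum_i \sum_j t (mu (E i) (F j)) (F i) (E j)
    + \sum_i \sum_j t (F j) (mu (F i) (E j)) (E i).
Proof.
have := rotate (fun i j l => t (F i) (F j) (E l)) => rot.
apply: etrans (eq_trans rot _); first by apply: eq_sum2 => i j; rewrite muEE sum3.
congr (_ + _); apply: eq_sum2 => i j; first by rewrite muEF sum1.
by rewrite muFE sum2.
Qed.

(* \sum_i (E i ⊗ F i - F i ⊗ E i) = \sum_i skew_left i ⊗ skew_right i *)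
Definition skew_left (i : 'I_(n + n)) : B :=
  match fintype.split i with inl j => E j | inr j => - F j end.

Definition skew_right (i : 'I_(n + n)) : B :=
  match fintype.split i with inl j => F j | inr j => E j end.

Lemma skew_sum (Y : zmodType) (f : B -> B -> Y) :
  (forall x y, f (- x) y = - f x y) ->
  \sum_i f (skew_left i) (skew_right i)
  = \sum_i f (E i) (F i) - \sum_i f (F i) (E i).
Proof.
move=> fN; rewrite big_split_ord /= -sumrN /skew_left /skew_right.
congr (_ + _); apply: eq_bigr => i _.
  by rewrite (unsplitK (inl i)).
by rewrite (unsplitK (inr i)) fN.
Qed.

Let t1N x y z : t (- x) y z = - t x y z. Proof. exact: (linN (t1 y z)). Qed.
Let t2N x y z : t x (- y) z = - t x y z. Proof. exact: (linN (t2 x z)). Qed.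
Let t10 y z : t 0 y z = 0. Proof. exact: (lin0 (t1 y z)). Qed.
Let t20 x z : t x 0 z = 0. Proof. exact: (lin0 (t2 x z)). Qed.
Let t30 x y : t x y 0 = 0. Proof. exact: (lin0 (t3 x y)). Qed.

Let G x y x' y' := t (mu x x') y y' + t x x' (mu y y') - t x' (mu x y') y.

Let GNl x y x' y' : G (- x) y x' y' = - G x y x' y'.
Proof. by rewrite /G !(bilinNl mb) !t1N t2N !opprD. Qed.

Let GNr x y x' y' : G x y (- x') y' = - G x y x' y'.
Proof. by rewrite /G !(bilinNr mb) !t1N t2N !opprD. Qed.

(* No associativity is needed: the terms of each type E ⊗ F ⊗ F, F ⊗ E ⊗ F,
   F ⊗ F ⊗ E cancel because c = p + s for the structure constants c of the
   product. *)
Lemma skew_sum_aybe : \sum_i \sum_j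
    (t (mu (skew_left i) (skew_left j)) (skew_right i) (skew_right j)
     + t (skew_left i) (skew_left j) (mu (skew_right i) (skew_right j))
     - t (skew_left j) (mu (skew_left i) (skew_right j)) (skew_right i)) = 0.
Proof.
transitivity (\sum_i \sum_j
  G (skew_left i) (skew_right i) (skew_left j) (skew_right j)); first by [].
(* Expands the form into four sums, (EF,EF) - (FE,EF) - (EF,FE) + (FE,FE). In all but (EF,FE) one
   term vanishes by [muFF], and a cycle identity reduces the rest to one sum. *)
under eq_bigr => i _ do rewrite (@skew_sum X (G _ _) (GNr _ _)).
rewrite sumrB.
rewrite (@skew_sum X (fun x y => \sum_j G x y (E j) (F j))); last first.
  by move=> x y; rewrite -sumrN; apply: eq_bigr => j _; exact: GNl.
rewrite (@skew_sum X (fun x y => \sum_j G x y (F j) (E j))); last first.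
  by move=> x y; rewrite -sumrN; apply: eq_bigr => j _; exact: GNl.
have -> : \sum_i \sum_j G (E i) (F i) (E j) (F j)
          = \sum_i \sum_j t (E i) (F j) (mu (F i) (E j)).
  transitivity (\sum_i \sum_j t (mu (E i) (E j)) (F i) (F j)
    - \sum_i \sum_j t (E j) (mu (E i) (F j)) (F i)).
    rewrite -sumrB; apply: eq_bigr => i _; rewrite -sumrB; apply: eq_bigr => j _.
    by rewrite /G muFF t30 addr0.
  by rewrite cycle1 addrC addKr.
have -> : \sum_i \sum_j G (F i) (E i) (E j) (F j)
          = \sum_i \sum_j t (F j) (mu (E i) (E j)) (F i).
  rewrite cycle2 addrC -big_split; apply: eq_bigr => i _; rewrite -big_split.
  by apply: eq_bigr => j _; rewrite /G muFF t20 subr0.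
have -> : \sum_i \sum_j G (F i) (E i) (F j) (E j)
          = \sum_i \sum_j t (mu (E i) (F j)) (F i) (E j).
  transitivity (\sum_i \sum_j t (F i) (F j) (mu (E i) (E j))
    - \sum_i \sum_j t (F j) (mu (F i) (E j)) (E i)).
    rewrite -sumrB; apply: eq_bigr => i _; rewrite -sumrB; apply: eq_bigr => j _.
    by rewrite /G muFF t10 add0r.
  by rewrite cycle3 addrK.
(* The three terms here are the reduced forms of the other three sums, with the signs that cancel
   them. *)
have -> : \sum_i \sum_j G (E i) (F i) (F j) (E j)
          = \sum_i \sum_j t (mu (E i) (F j)) (F i) (E j)
            + \sum_i \sum_j t (E i) (F j) (mu (F i) (E j))
            - \sum_i \sum_j t (F j) (mu (E i) (E j)) (F i).
  rewrite -big_split -sumrB; apply: eq_bigr => i _; rewrite -big_split -sumrB.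
  by apply: eq_bigr.
by rewrite -[X in _ - (X - _)]addrA [X in _ - (X - _)]addrC addrK subrr.
Qed.

End StructureConstants.

(** * The tensor r, its scalar deformation and the AYBE over k[[h]] *)

Section CanonicalTensor.
Variable k : fieldType.
Implicit Types A V W : vectType k.

Lemma tflip_ten V W (v : V) (w : W) : tflip (ten v w) = ten w v.
Proof. by case: (ten_bilin W V) => tl tr; apply: tlift_ten. Qed.

Lemma teta_ten V W (v : V) (w : W) :
  teta (ten v w) = ten ((v, 0) : dsum V W) ((0, w) : dsum V W).
Proof.
have [tl tr] := ten_bilin (dsum V W) (dsum V W).
apply: tlift_ten; split=> [y|x] a u v'.
  rewrite -tl; congr ten; apply: injective_projections => //=.
  by rewrite scaler0 addr0.
rewrite -tr; congr ten; apply: injective_projections => //=.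
by rewrite scaler0 addr0.
Qed.

Definition idtensor A : tens (dsum A (dual A)) (dsum A (dual A)) :=
  teta (map_tensor (fun x : A => x)) - tflip (teta (map_tensor (fun x : A => x))).

Definition einl A i : dsum A (dual A) := (ebas i, 0).
Definition einr A i : dsum A (dual A) := (0, edual i).

(** Writes r as a single sum of pure tensors, the form needed by [aybe_formE], [cybe_formE] and
    [skew_sum_aybe]. *)
Lemma idtensorE A : idtensor A =
  \sum_i ten (skew_left (@einl A) (@einr A) i) (skew_right (@einl A) (@einr A) i).
Proof.
rewrite /idtensor /map_tensor.
have [bl _] := ten_bilin (dsum A (dual A)) (dsum A (dual A)).
rewrite /teta /tflip !(lin_sum (tlift_lin _)).
rewrite skew_sum; last by move=> x y; exact: (linN (bl y)).
congr (_ - _); apply: eq_bigr => i _; first exact: teta_ten.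
by rewrite [tlift _ (ten _ _)]teta_ten [LHS]tflip_ten.
Qed.

Lemma tflip_lin V W : linear (@tflip k V W).
Proof. exact: tlift_lin. Qed.

Lemma tflipK V W (t : tens V W) : tflip (tflip t) = t.
Proof.
have [l1 l2] := (@tflip_lin V W, @tflip_lin W V).
rewrite {1}(tens_basis t) [RHS]tens_basis (lin_sum l1) (lin_sum l2).
apply: eq_bigr => i _; rewrite (lin_sum l1) (lin_sum l2); apply: eq_bigr => j _.
by rewrite (linZ l1) (linZ l2) !tflip_ten.
Qed.

Lemma idtensor_skew A : skew_sym (idtensor A).
Proof.
rewrite /skew_sym /idtensor; set r := teta _.
have -> : tflip (r - tflip r) = tflip r - r; last by rewrite addrA subrK subrr.
by rewrite (linD (@tflip_lin _ _)) (linN (@tflip_lin _ _)) tflipK.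
Qed.

Lemma fcst_sum V I (e : seq I) (P : pred I) (f : I -> V) :
  fcst (\sum_(i <- e | P i) f i) = \sum_(i <- e | P i) fcst (f i).
Proof. by apply: big_morph; [exact: fcst_is_additive | apply: fpsP => -[]]. Qed.

Lemma smap_cst (U V : zmodType) (T : U -> V) (x : U) :
  T 0 = 0 -> smap T (fcst x) = fcst (T x).
Proof. by move=> T0; apply: fpsP => -[|n]. Qed.

Lemma hmap_tensor_id A :
  hmap_tensor (fun x : fps A => x) = hat (map_tensor (fun x : A => x)).
Proof.
by rewrite /hat fcst_sum; apply: eq_bigr => i _; rewrite -hat_ten.
Qed.

(** The identity of A_h sends the constant basis to itself, and [hteta] and [htflip] act
    coefficientwise, so r_h is a constant series. *)
Lemma hat_idtensor A :
  hteta (hmap_tensor (fun x : fps A => x))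
    - htflip (hteta (hmap_tensor (fun x : fps A => x))) = hat (idtensor A).
Proof.
have t0 V W (X : lmodType k) (f : V -> W -> X) : tlift f 0 = 0.
  exact: (lin0 (@tlift_lin _ _ _ _ f)).
rewrite hmap_tensor_id /hteta /htflip !smap_cst //; try exact: t0.
by apply: fpsP => -[|n]; rewrite fpsD fpsN //= subr0.
Qed.

Lemma dual_basis V (u : dual V) :
  u = \sum_i (u : 'Hom(V, k^o)) (ebas i) *: edual i.
Proof.
apply/lfunP => v; rewrite sum_lfunE {1}(ebasE v) linear_sum.
apply: eq_bigr => i _; rewrite linearZ scale_lfunE edualE.
by rewrite /GRing.scale /= mulrC.
Qed.

Lemma inl_linear A V : linear (fun x : A => (x, 0) : dsum A V).
Proof.
by move=> a x y; apply: injective_projections => //=; rewrite scaler0 addr0.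
Qed.

Lemma inr_linear A V : linear (fun x : V => (0, x) : dsum A V).
Proof.
by move=> a x y; apply: injective_projections => //=; rewrite scaler0 addr0.
Qed.

Lemma hjoin_inl A (v : fps A) :
  hjoin (v, 0) = \sum_l ((fun m => ecoord l (v m)) : fps k) *: fcst (einl l).
Proof.
apply: fpsP => m; rewrite fps_sum; under eq_bigr do rewrite fpsZ_cst.
have fl := @inl_linear A (dual A); rewrite /hjoin /=.
transitivity ((fun x : A => (x, 0) : dsum A (dual A)) (v m)) => //.
rewrite {1}(ebasE (v m)) (lin_sum fl); apply: eq_bigr => l _.
exact: (linZ fl).
Qed.

Lemma hjoin_inr A (u : fps (dual A)) :
  hjoin (0, u) = \sum_l ((fun m => (u m : 'Hom(A, k^o)) (ebas l)) : fps k)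
                   *: fcst (einr l) :> fps (dsum A (dual A)).
Proof.
apply: fpsP => m; rewrite fps_sum; under eq_bigr do rewrite fpsZ_cst.
have fl := @inr_linear A (dual A); rewrite /hjoin /=.
transitivity ((fun x : dual A => (0, x) : dsum A (dual A)) (u m)) => //.
rewrite {1}(dual_basis (u m)) (lin_sum fl); apply: eq_bigr => l _.
exact: (linZ fl).
Qed.

Section Bilinear.
Variables (A : vectType k) (succh prech : fps A -> fps A -> fps A).
Hypotheses (sb : bilin succh) (pb : bilin prech).

Let mulh := hsdprod (dsum_op succh prech) (opp_rep (hdual_rep (Rmul prech)))
  (opp_rep (hdual_rep (Lmul succh))).

Let rpb : bilin (Rmul prech). Proof. exact: (bilin_flip pb). Qed.
Let lsb : bilin (Lmul succh). Proof. exact: sb. Qed.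

Let cb : bilin (dsum_op succh prech). Proof. exact: bilin_add. Qed.
Let lb : bilin (opp_rep (hdual_rep (Rmul prech))).
Proof. exact: bilin_opp (hdual_rep_bilin rpb). Qed.
Let rb : bilin (opp_rep (hdual_rep (Lmul succh))).
Proof. exact: bilin_opp (hdual_rep_bilin lsb). Qed.

Lemma double_bilin : bilin mulh.
Proof. exact: hsdprod_bilin. Qed.

Let fcst0 V : fcst (0 : V) = 0. Proof. by apply: fpsP => -[]. Qed.

Let s i j l : fps k := fun m => ecoord l (succh (fcst (ebas i)) (fcst (ebas j)) m).
Let p i j l : fps k := fun m => ecoord l (prech (fcst (ebas i)) (fcst (ebas j)) m).

Lemma hat_idtensor_AYBE : hAYBE mulh (hat (idtensor A)).
Proof.
rewrite /hAYBE idtensorE /hat fcst_sum.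
under eq_bigr do rewrite -/(hat _) hat_ten.
rewrite (haybe_formE _ _ double_bilin).
pose E (i : 'I_(\dim {:A})) := fcst (@einl A i).
pose F (i : 'I_(\dim {:A})) := fcst (@einr A i).
have lE i : fcst (skew_left (@einl A) (@einr A) i) = skew_left E F i.
  rewrite /skew_left; case: fintype.split => j //.
  by apply: fpsP => -[|m]; rewrite fpsN //= oppr0.
have rE i : fcst (skew_right (@einl A) (@einr A) i) = skew_right E F i.
  by rewrite /skew_right; case: fintype.split.
under eq_bigr => i _ do under eq_bigr => j _ do rewrite !lE !rE.
have inE x : hsplit (fcst ((x, 0) : dsum A (dual A))) = (fcst x, 0).
  by rewrite hsplit_cst fcst0.
have inrE u : hsplit (fcst ((0, u) : dsum A (dual A))) = (0, fcst u).
  by rewrite hsplit_cst fcst0.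
have cb0 := (bilin0l cb, bilin0r cb, bilin0l lb, bilin0r lb, bilin0l rb, bilin0r rb).
have tb V W := hten_bilin V W.
(* The base ring is k[[h]] here: [s] and [p] are power series, while the bases [E] and [F] are
   constant. *)
apply: (@skew_sum_aybe _ _ _ _ mulh (fun x y z => hten x (hten y z))
  _ _ _ _ E F s p).
- exact: double_bilin.
- by move=> y z; exact: (tb _ _).1.
- by move=> x z a u v; rewrite (tb _ _).1 (tb _ _).2.
- by move=> x y a u v; rewrite !(tb _ _).2.
- move=> i j; rewrite /mulh /hsdprod !inE /sdprod /= !cb0 addr0 hjoin_inl.
  apply: eq_bigr => l _; congr (_ *: _); apply: fpsP => m.
  by rewrite fpsD /dsum_op fpsD /p /s [LHS](linD (ecoord_lin _)).
(* The transposed action of e_i on e_j^*, evaluated at e_l, is e_j^*(e_l ≺ e_i), which is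
   [p l i j]. *)
- move=> i j; rewrite /mulh /hsdprod inE inrE /sdprod /= !cb0 addr0 hjoin_inr.
  apply: eq_bigr => l _; congr (_ *: _); apply: fpsP => m.
  rewrite /opp_rep fpsN opp_lfunE hdual_rep_coef // opprK /hpair cauchy_cstl ?edualE //.
  by move=> w; rewrite zero_lfunE.
- move=> i j; rewrite /mulh /hsdprod inE inrE /sdprod /= !cb0 add0r hjoin_inr.
  apply: eq_bigr => l _; congr (_ *: _); apply: fpsP => m.
  rewrite /opp_rep fpsN opp_lfunE hdual_rep_coef // opprK /hpair cauchy_cstl ?edualE //.
  by move=> w; rewrite zero_lfunE.
move=> i j; rewrite /mulh /hsdprod !inrE /sdprod /= !cb0 addr0.
by apply: fpsP.
Qed.

End Bilinear.
End CanonicalTensor.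

(** * Reduction of the AYBE mod h, and the CYBE *)

Section Reductions.
Variable k : fieldType.
Implicit Types A V W X : vectType k.

Lemma modh_sum V I (e : seq I) (P : pred I) (f : I -> fps V) :
  modh (\sum_(i <- e | P i) f i) = \sum_(i <- e | P i) modh (f i).
Proof. exact: fps_sum. Qed.

Lemma modh_htlift V W X (f : fps V -> fps W -> fps X) (t : tens V W) :
  modh (htlift f (hat t)) = tlift (fun v w => modh (f (fcst v) (fcst w))) t.
Proof.
rewrite /htlift modh_sum; apply: eq_bigr => i _.
rewrite modh_sum; apply: eq_bigr => j _; rewrite -modh_cstZ.
by congr (modh (_ *: _)); apply: fpsP => -[|n]; rewrite /hcoef //= mxE.
Qed.

Lemma modh_hten V W (v : fps V) (w : fps W) :
  modh (hten v w) = ten (modh v) (modh w).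
Proof. by rewrite /modh /hten /cauchy big_ord_recl big_ord0 addr0. Qed.

Lemma modh_haybe_form V (muh : fps V -> fps V -> fps V) (mu : V -> V -> V)
    (r : tens V V) :
  reduces_to muh mu -> modh (haybe_form muh (hat r)) = aybe_form mu r.
Proof.
move=> mm; rewrite /haybe_form modh_htlift; congr (tlift _ r).
apply/funext => a; apply/funext => b; rewrite modh_htlift; congr (tlift _ r).
apply/funext => a'; apply/funext => b'.
by rewrite !modhD modhN !modh_hten !mm.
Qed.

(* the third terms of A(r) and C(r) are exchanged by i <-> j *)
Lemma cybe_form_skew V (br : V -> V -> V) n (a b : 'I_n -> V) :
  bilin br -> (forall x y, br x y = - br y x) ->
  cybe_form br (\sum_i ten (a i) (b i)) = aybe_form br (\sum_i ten (a i) (b i)).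
Proof.
move=> bb brC; rewrite cybe_formE // aybe_formE //.
have tb U W := ten_bilin U W.
(* [addrAC] moves the middle term of C(r) to the end, facing the last term of A(r). *)
under eq_bigr do (under eq_bigr do rewrite addrAC; rewrite big_split).
under [RHS]eq_bigr do rewrite big_split.
rewrite !big_split; congr (_ + _); rewrite exchange_big.
apply: eq_bigr => i _; apply: eq_bigr => j _.
by rewrite brC (bilinNl (tb _ _)) (bilinNr (tb _ _)).
Qed.

Lemma dual_rep_bilin A V (rho : A -> V -> V) :
  bilin rho -> bilin (dual_rep rho).
Proof.
move=> rb; split=> [u|x] a y z; apply/lfunP => v;
  rewrite add_lfunE scale_lfunE !dual_repE; try exact: rb.2.
  by rewrite (bilinDl rb) (bilinZl rb) linearD linearZ opprD scalerN.
by rewrite add_lfunE scale_lfunE opprD scalerN.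
Qed.

(** The operations are extended to k[[h]] by Cauchy products, and the solution found there is
    reduced mod h. *)
Lemma idtensor_AYBE A (succ prec : A -> A -> A) : bilin succ -> bilin prec ->
  AYBE (sdprod (dsum_op succ prec) (opp_rep (dual_rep (Rmul prec)))
          (opp_rep (dual_rep (Lmul succ))) : dsum A (dual A) -> _)
    (idtensor A).
Proof.
move=> sb pb.
have ext (f : A -> A -> A) : bilin f ->
    bilin (cauchy f : fps A -> fps A -> fps A) /\ reduces_to (cauchy f) f.
  move=> fb; split; first by split; [exact: cauchy_linl fb.1|exact: cauchy_linr fb.2].
  by move=> x y; rewrite /modh /cauchy big_ord_recl big_ord0 addr0.
have [[shb sr] [phb pr]] := (ext _ sb, ext _ pb).
have rphb : bilin (Rmul (cauchy prec)) by exact: bilin_flip phb.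
rewrite /AYBE -(@modh_haybe_form _ _ _ _ (@hsdprod_reduces _ _ _
  (dsum_op (cauchy succ) (cauchy prec))
  (opp_rep (hdual_rep (Rmul (cauchy prec))))
  (opp_rep (hdual_rep (Lmul (cauchy succ)))) _ _ _ _ _ _)).
- by rewrite hat_idtensor_AYBE.
- by move=> x y; rewrite /dsum_op modhD sr pr.
- apply/opp_rep_reduces/hdual_rep_reduces => // x y.
  exact: pr.
- exact/opp_rep_reduces/hdual_rep_reduces.
Qed.

Lemma idtensor_CYBE A (tri : A -> A -> A) : bilin tri ->
  CYBE (sdbracket (commutator tri) (dual_rep (Lmul tri)) : dsum A (dual A) -> _)
    (idtensor A).
Proof.
move=> tb; set br := sdbracket _ _.
have ntb : bilin (fun x y => - tri y x) by exact/bilin_opp/bilin_flip.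
(* With x ≺ y = - y ▷ x the sum of the operations is the commutator of ▷, and -R_≺^* = L_▷^*, so
   this product is the bracket. *)
pose mu : dsum A (dual A) -> dsum A (dual A) -> dsum A (dual A) :=
  sdprod (dsum_op tri (fun x y => - tri y x))
    (opp_rep (dual_rep (Rmul (fun x y => - tri y x))))
    (opp_rep (dual_rep (Lmul tri))).
have br_mu : br = mu.
  apply/funext => x; apply/funext => y; congr pair.
    by rewrite /commutator /dsum_op addrC.
  congr (_ + _); apply/lfunP => v; rewrite /opp_rep opp_lfunE !dual_repE.
  - by rewrite opprK /Rmul linearN.
  - exact: ntb.1.
  exact: tb.2.
have brC x y : br x y = - br y x.
  by apply: injective_projections; exact: esym (opprB _ _).
have brb : bilin br.
  rewrite br_mu; apply: sdprod_bilin; first exact: bilin_add.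
    exact: bilin_opp (dual_rep_bilin (bilin_flip ntb)).
  exact: bilin_opp (dual_rep_bilin tb).
rewrite /CYBE idtensorE cybe_form_skew // -idtensorE br_mu.
exact: idtensor_AYBE.
Qed.

End Reductions.

(** * Assembly of the quasiclassical limits and the Yang-Baxter solutions *)

Theorem corollary4p19 (k : fieldType) (char0 : [pchar k] =i pred0)
    (A : vectType k) (succ : A -> A -> A)
    (succh prech : fps A -> fps A -> fps A)
    (zinb : zinbiel_algebra succ)
    (deform : dendriform_deformation succh prech succ (Rmul succ)) :
  let tri : A -> A -> A := qcl_prelie succh prech in
  let circ : A -> A -> A := zinbiel_prod succ in
  let br : A -> A -> A := commutator tri in
  let circh : fps A -> fps A -> fps A := dsum_op succh prech in
  let B : vectType k := dsum A (dual A) in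
  (* A ⋉_{-L_succ^*} A^* *)
  let mulB : B -> B -> B :=
    sdprod circ (opp_rep (dual_rep (Lmul succ)))
                (opp_rep (dual_rep (Lmul succ))) in
  (* the bracket of A ⋉_{L_tri^*, -L_succ^*} A^* *)
  let brB : B -> B -> B := sdbracket br (dual_rep (Lmul tri)) in
  (* A_h ⋉_{-R_prech^*, -L_succh^*} A_h^* *)
  let mulBh : fps B -> fps B -> fps B :=
    hsdprod circh (opp_rep (hdual_rep (Rmul prech)))
                  (opp_rep (hdual_rep (Lmul succh))) in
  let idA : A -> A := fun x => x in
  let idAh : fps A -> fps A := fun x => x in
  let r : tens B B :=
    teta (map_tensor idA) - tflip (teta (map_tensor idA)) in
  let rh : fps (tens B B) :=
    hteta (hmap_tensor idAh) - htflip (hteta (hmap_tensor idAh)) in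
  [/\ prepoisson_algebra tri succ,
      (* (1) *)
      assoc_deformation mulBh mulB /\ quasiclassical_limit mulBh brB mulB,
      (* (2), starting from the Zinbiel algebra *)
      [/\ o_operator_scalar_deformation circh (Lmul succh) (Rmul prech) idAh
             circ (Lmul succ) idA,
          skew_sym r /\ hskew_sym rh
        & aybe_scalar_deformation mulBh rh mulB r]
    & (* (2), starting from the dendriform algebra *)
      o_operator_qcl circh (Lmul succh) (Rmul prech) idAh
        br circ (Lmul tri) (Lmul succ) idA
      /\ pybe_qcl mulBh rh brB mulB r].
Proof.

move=> tri circ br circh B mulB brB mulBh idA idAh r rh.
have [zd dh s_succ s_prec] := deform.
have [sb pb _ _ _] := dh; have [sb0 _ _ _ _] := zd.
have rpb : bilin (Rmul prech) by exact: bilin_flip pb.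
have pr : reduces_to (Rmul prech) succ := prec_reduces deform.
have cr : reduces_to circh circ := circ_reduces deform.
have circhA : assoc_algebra circh := dendriform_assoc dh.
have laws := dendriform_bimodule_laws dh.
have dlaws := hdual_bimodule_laws laws.
have circC : commutative circ by move=> x y; exact: addrC.
(* Views the Zinbiel algebra as a dendriform algebra, so that the dendriform lemmas apply to it. *)
have circE : circ = dsum_op succ (Rmul succ).
  by apply/funext => x; apply/funext => y; exact: addrC.
have brE : br = qcl_op circh (Rmul circh) := commutator_qcl_prelie deform.
have triE : tri = qcl_op (Lmul succh) (Rmul prech) by [].
have prepoisson : prepoisson_algebra tri succ := qcl_prelie_prepoisson deform.
have trib : bilin tri by case: prepoisson => _ [].
have qclB : quasiclassical_limit mulBh brB mulB.
  (* Both components of the bracket become limits of differences over k[[h]], taken in the dual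
     bimodule. *)
  rewrite /brB brE triE -(hdual_qcl_op _ rpb s_succ) //.
  apply: hsdprod_quasiclassical_limit => //.
    exact/opp_rep_reduces/hdual_rep_reduces.
  exact/opp_rep_reduces/hdual_rep_reduces.
have [defB _ _ _] := qclB.
have rhE : rh = hat r := hat_idtensor A.
have rAYBE : AYBE mulB r.
  (* [Rmul (Rmul succ)] is [succ], so both dual actions in the double are -L_≻^*. *)
  by rewrite /mulB circE; apply: idtensor_AYBE => //; exact: bilin_flip.
have rhAYBE : hAYBE mulBh rh by rewrite rhE; exact: hat_idtensor_AYBE.
have rPYBE : PYBE brB mulB r by split=> //; exact: idtensor_CYBE.
have rskew : skew_sym r := idtensor_skew A.
have qclA : quasiclassical_limit circh br circ.
  by rewrite brE; exact: quasiclassical_limitP.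
have [defA _ _ _] := qclA.
have opA : o_operator circ (Lmul succ) (Lmul succ) idA.
  by rewrite circE; exact: (dendriform_o_operator zd).
have opAh : o_operator circh (Lmul succh) (Rmul prech) idAh.
  exact: dendriform_o_operator.
split; [by [] | by [] | |].
- split=> //; split=> //; rewrite rhE /hskew_sym /htflip smap_cst.
    by rewrite -fcst_is_additive [_ + _]rskew; apply: fpsP => -[].
  exact: (lin0 (@tflip_lin _ _ _)).
split; last by split=> //; rewrite rhE.
(* The module axioms come from the limit of the semidirect product of A_h with its own bimodule. *)
have module : poisson_module br circ (Lmul tri) (Lmul succ).
  have [_ _ brP _] := qclA.
  have := hsdprod_quasiclassical_limit circhA laws circC cr s_succ pr.
  by rewrite -brE -triE => -[].
by split; split.
Qed.
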